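(* Let $k\ge 3$ and $\frac1k<r_0<\frac1{k-1}$, and let $\sigma_k$, the lenses $L_j$ and the counts $m_j=\#(\mathcal P_\lambda\cap L_j)$, $j=1,\dots,k-1$, be as in the context. Then for every integer $n\ge 0$, $$\mathbb P\big(\sigma_k=n \,\big|\, m_1,\dots,m_{k-1}\big)=\frac{1}{\binom{m_1+\cdots+m_{k-1}}{m_1,\ldots,m_{k-1}}}\sum_{w\in\mathcal P(\mathcal M_{k-2})}\ \sum_{\substack{\Pi\in\mathcal P([m_{k-2}\times m_{k-1}])\\ S(w)\cdot\pi^\star(\Pi)=n}}\ \prod_{r=0}^{m_{k-2}}\binom{\pi^\star(\Pi)(r)+\sum_{l=1}^{k-3}\pi^\star_{k-2,l}(w)(r)}{\pi^\star(\Pi)(r)},$$ where the outer sum runs over words in $\mathcal P(\mathcal M_{k-2})$ built from the counts $m_1,\dots,m_{k-2}$ (an empty sum over $l$ equals $0$).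
   Context: Fix $\lambda>0$. Let $\mathcal P_\lambda$ be a homogeneous Poisson point process of intensity $\lambda$ on $[0,1]$. Set $V=\mathcal P_\lambda\cup\{0,1\}$ and let $G$ be the graph on $V$ in which distinct $x,y$ are adjacent iff $|x-y|<r_0$. A $k$-hop path from $0$ to $1$ is a sequence of vertices $0=v_0,v_1,\dots,v_k=1$ of $G$ with $v_{i-1}$ adjacent to $v_i$ for all $i$. $\sigma_k$ denotes the number of such paths. For $j=1,\dots,k-1$, the lens is $L_j=(1-(k-j)r_0,\; j r_0)$. Under $\frac1k<r_0<\frac1{k-1}$ these are pairwise disjoint intervals of length $kr_0-1>0$. Set $m_j=\#(\mathcal P_\lambda\cap L_j)$. Words / lattice paths: for nonnegative integers $m_1,\dots,m_d$, $\mathcal P(\mathcal M_d)$ is the set of words of length $m_1+\dots+m_d$ in letters $e_1,\dots,e_d$ containing exactly $m_i$ copies of $e_i$. Equivalently, these are lattice paths with unit steps $e_i$ from $\mathbf 0$ to $(m_1,\dots,m_d)$ in $\{0,\dots,m_1\}\times\cdots\times\{0,\dots,m_d\}$. For a word $w$ and $i\neq j$, write $\pi_{i,j}(w)(s)$, $s=1,\dots,m_j$, for the number of occurrences of $e_i$ in $w$ preceding the $s$-th occurrence of $e_j$. Its multiplicity function is $\pi^\star_{i,j}(w)(r)=\#\{s:\pi_{i,j}(w)(s)=r\}$ for $r=0,\dots,m_i$. In particular, $\pi^\star_{k-2,l}(w)(r)$ is the number of letters $e_l$ lying strictly after the $r$-th and before the $(r+1)$-th occurrence of $e_{k-2}$.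 For $w\in\mathcal P(\mathcal M_d)$ and $t=0,\dots,m_d$, $S_t(w)$ is the number of $d$-tuples of positions $p_1<\dots<p_d$ in $w$ such that the letter at $p_i$ is $e_i$ for each $i$, and $p_d$ is at or before the $t$-th occurrence of $e_d$. So $S_0=0$, and for $d=1$, $S_t=t$. Write $S(w)=(S_0(w),\dots,S_{m_d}(w))$. $\mathcal P([m_{k-2}\times m_{k-1}])$ is the set of words with $m_{k-2}$ letters $a$ and $m_{k-1}$ letters $b$. For such $\Pi$, $\pi(\Pi)(s)$ is the number of $a$'s preceding the $s$-th $b$ ($s=1,\dots,m_{k-1}$), and $\pi^\star(\Pi)(r)=\#\{s:\pi(\Pi)(s)=r\}$ for $r=0,\dots,m_{k-2}$. The dot product is $S(w)\cdot\pi^\star(\Pi)=\sum_{r=0}^{m_{k-2}}S_r(w)\,\pi^\star(\Pi)(r)$. The multinomial coefficient is $\binom{m_1+\cdots+m_{k-1}}{m_1,\ldots,m_{k-1}}=\frac{(m_1+\dots+m_{k-1})!}{m_1!\cdots m_{k-1}!}$. *)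

(* Defs.v *)
From HB Require Import structures.
From mathcomp Require Import all_boot all_order all_algebra.
From mathcomp Require Import all_classical all_reals all_analysis.

Set Implicit Arguments.
Unset Strict Implicit.
Unset Printing Implicit Defensive.

Import Order.TTheory GRing.Theory Num.Theory.
Local Open Scope classical_set_scope.
Local Open Scope ring_scope.

(* Poisson(mu) probability mass function (also correct for mu = 0). *)
Definition pois_pmf {R : realType} (mu : R) (c : nat) : R :=
  mu ^+ c / (c`!)%:R * expR (- mu).

Definition npts {R : realType} (A : set R) (s : seq R) : nat :=
  count (fun x => `[< A x >]) s.

Definition is_poisson_pp {R : realType} (d : measure_display)
    (T : measurableType d) (P : probability T R) (lam : R)
    (X : T -> seq R) : Prop :=
  [/\ forall t, all (fun x => (0 <= x <= 1)) (X t),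
      forall (A : set R) (c : nat), measurable A ->
        measurable [set t | npts A (X t) = c] &
      forall (p : nat) (A : 'I_p -> set R) (c : 'I_p -> nat),
        (forall i, measurable (A i) /\ A i `<=` `[0, 1]%classic) ->
        (forall i j, i != j -> A i `&` A j = set0) ->
        P (\bigcap_(i in [set: 'I_p]) [set t | npts (A i) (X t) = c i])
          = (\prod_(i < p) pois_pmf (lam * fine (lebesgue_measure (A i))) (c i))%:E].

Definition cond_prob {R : realType} (d : measure_display)
    (T : measurableType d) (P : probability T R) (A B : set T) : R :=
  fine (P (A `&` B)) / fine (P B).

Definition vertices {R : realType} (s : seq R) : seq R := undup (0 :: 1 :: s).

Definition adj {R : realType} (r0 : R) (x y : R) : bool :=
  (x != y) && (`|x - y| < r0).

Fixpoint walks_from0 {R : realType} (V : seq R) (r0 : R) (i : nat) (y : R)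
    : nat :=
  match i with
  | 0 => (y == 0)
  | i'.+1 => \sum_(x <- V) walks_from0 V r0 i' x * adj r0 x y
  end.

Definition sigma_k {R : realType} (k : nat) (r0 : R) (s : seq R) : nat :=
  walks_from0 (vertices s) r0 k 1.

Definition lens {R : realType} (k j : nat) (r0 : R) : set R :=
  `]1 - (k - j)%:R * r0, j%:R * r0[%classic.

Definition pistar {T : eqType} (w : seq T) (i j : T) (r : nat) : nat :=
  count (fun p => (nth j w p == j) && (count_mem i (take p w) == r))
        (iota 0 (size w)).

Definition Sfun (d : nat) (w : seq nat) (t : nat) : nat :=
  #|[pred p : {ffun 'I_d -> 'I_(size w)} |
      [&& [forall i : 'I_d, forall i' : 'I_d, (i < i')%N ==> (p i < p i')%N],
          [forall i : 'I_d, nth 0%N w (p i) == i.+1] &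
          [forall i : 'I_d, (i.+1 == d) ==>
              (count_mem d (take (p i).+1 w) <= t)%N]]]|.

(* P(M_d) for counts m 1, ..., m d: words of length m 1 + ... + m d over
   letters 1..d with exactly m i copies of letter i.  A word is encoded as a
   tuple over 'I_d, letter i : 'I_d standing for e_{i+1}. *)
Definition wordsP (d : nat) (m : nat -> nat) (w : (\sum_(1 <= i < d.+1) m i).-tuple 'I_d) : bool :=
  [forall i : 'I_d, count_mem i w == m i.+1].

Definition word_letters (d : nat) (N : nat) (w : N.-tuple 'I_d) : seq nat :=
  map (fun x : 'I_d => (val x).+1) w.

(* P([a x b]): words with a letters a (= false) and b letters b (= true) *)
Definition wordsAB (a b : nat) (P : (a + b).-tuple bool) : bool :=
  count_mem true P == b.

Definition multinom (q : nat) (m : nat -> nat) : nat :=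
  (\sum_(1 <= j < q.+1) m j)`! %/ \prod_(1 <= j < q.+1) (m j)`!.

Definition rhs21 {R : realType} (k : nat) (m : nat -> nat) (n : nat) : R :=
  (multinom (k - 1)%N m)%:R^-1 *
  (\sum_(w : (\sum_(1 <= i < (k - 2)%N.+1) m i).-tuple 'I_(k - 2)%N | wordsP w)
    \sum_(Pi : (m (k - 2)%N + m (k - 1)%N).-tuple bool |
            wordsAB Pi &&
            ((\sum_(r < (m (k - 2)%N).+1)
                Sfun (k - 2)%N (word_letters w) r * pistar Pi false true r)%N
             == n))
      (\prod_(r < (m (k - 2)%N).+1)
         'C(pistar Pi false true r
            + \sum_(1 <= l < (k - 2)%N) pistar (word_letters w) (k - 2)%N l r,
            pistar Pi false true r))%:R).

(* Main.v *)
Require Import Defs.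
From HB Require Import structures.
From mathcomp Require Import all_boot all_order all_algebra.
From mathcomp Require Import all_classical all_reals all_analysis.
From mathcomp Require Import zify ring lra.
Import Order.TTheory GRing.Theory Num.Theory.

(** A [k]-hop path must visit the lenses [L_1, ..., L_(k-1)] in this order.
    Measuring a point [x] of [L_j] by its offset [j r0 - x], which ranges over
    the same interval [(0, k r0 - 1)] for all lenses, two points of consecutive
    lenses are adjacent iff the offset increases.  Hence [sigma_k] is the number
    of subsequences [e_1 ... e_(k-1)] of the word obtained by reading the lens
    points in order of increasing offset.

    This word is conditionally uniform: cut every lens into [N] cells of equal
    length; the events "the cells spell [w], with at most one point per offset"
    are disjoint and all have the same probability, and [C(N, M)] of them
    produce a given word of length [M].  As [N] grows this gives lower bounds
    for the probabilities of [sigma_k = n] and of its complement which add up to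
    the whole mass, so both are equalities.

    Finally, words over [k-1] letters with [n] such subsequences are counted
    through their restrictions [w] to the first [k-2] letters and [Pi] to the
    last two: a pair has one shuffle for each way of interleaving, inside every
    gap between letters [e_(k-2)], the letters [e_(k-1)] with the lower ones. *)

(** * Subsequences of words *)

(* Number of chains [b_1 < ... < b_i < a] with [b_j] occupied at level [j].  Both
   the subsequences of a word and the paths through the lenses have this form. *)
Fixpoint nchain (occ : nat -> nat -> bool) (i a : nat) : nat :=
  if i is i'.+1 then \sum_(b < a) occ i b * nchain occ i' b else 1.

Lemma eq_nchain occ occ' i a :
  (forall j b, 1 <= j <= i -> b < a -> occ j b = occ' j b) ->
  nchain occ i a = nchain occ' i a.
Proof.
elim: i a => [//|i IH] a eqo /=; apply: eq_bigr => b _.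
rewrite eqo ?leqnn//; congr (_ * _); apply: IH => j c /andP[j1 ji] cb.
by rewrite eqo// ?j1 ?(leqW ji)// (ltn_trans cb).
Qed.

Definition letter_at (w : seq nat) (j a : nat) : bool := nth 0 w a == j.

(** The number of occurrences of [1 2 ... d] as a scattered subword of [w]. *)
Definition nsub (d : nat) (w : seq nat) : nat := nchain (letter_at w) d (size w).

Lemma nchain_take d w a : a <= size w ->
  nchain (letter_at w) d a = nsub d (take a w).
Proof.
move=> aw; rewrite /nsub size_takel//; apply: eq_nchain => j b _ ba.
by rewrite /letter_at nth_take.
Qed.

(** The subsequences gained by appending [x] end at the new last position, which forces [x] to be
    the top letter. *)
Lemma nsub_rcons d w x :
  nsub d.+1 (rcons w x) = nsub d.+1 w + (x == d.+1) * nsub d w.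
Proof.
rewrite {1}/nsub /= size_rcons big_ord_recr /= /letter_at nth_rcons ltnn eqxx.
rewrite nchain_take ?size_rcons// -cats1 take_size_cat//; congr (_ + _).
apply: eq_bigr => b _; rewrite /letter_at nth_cat ltn_ord; congr (_ * _).
apply: eq_nchain => j c _ cb.
by rewrite /letter_at nth_cat (ltn_trans cb).
Qed.

(** Letters outside [1, ..., d] enter no chain, so blanks or a higher top letter can be erased. *)
Lemma nsub_filter (p : pred nat) d w :
  (forall j, 1 <= j <= d -> p j) -> nsub d [seq x <- w | p x] = nsub d w.
Proof.
elim/last_ind: w d => [//|w x IH] [|d] pd //.
rewrite filter_rcons nsub_rcons -IH//.
have dd : forall j, 1 <= j <= d -> p j.
  by move=> j /andP[j1 jd]; apply: pd; rewrite j1 (leqW jd).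
case: ifPn => px; first by rewrite nsub_rcons (IH d).
by case: eqP px => [->|_ _]; rewrite ?pd ?leqnn// mul0n addn0.
Qed.

(** The position tuples counted by [Sfun], with an arbitrary condition [Q] on the last position. The
    generality serves the induction on [d]: dropping the last position [x] leaves the condition
    [y < x] on the one before. *)
Definition chain_pred (n : nat) (w : seq nat) (d : nat) (Q : pred 'I_n)
    (p : {ffun 'I_d -> 'I_n}) : bool :=
  [&& [forall i : 'I_d, forall j : 'I_d, (i < j) ==> (p i < p j)],
      [forall i : 'I_d, nth 0 w (p i) == i.+1] &
      [forall i : 'I_d, (i.+1 == d) ==> Q (p i)]].

Definition ffun_rcons (n d : nat) (x : 'I_n) (p : {ffun 'I_d -> 'I_n}) :
    {ffun 'I_d.+1 -> 'I_n} :=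
  [ffun i => if unlift ord_max i is Some j then p j else x].

Lemma chain_pred_rcons n w d (Q : pred 'I_n) x (p : {ffun 'I_d -> 'I_n}) :
  @chain_pred n w d.+1 Q (ffun_rcons n d x p) =
  [&& nth 0 w x == d.+1, Q x &
      @chain_pred n w d (fun y => y < x) p].
Proof.
have fm : ffun_rcons n d x p ord_max = x by rewrite ffunE unlift_none.
have fl i : ffun_rcons n d x p (lift ord_max i) = p i by rewrite ffunE liftK.
have lm (i : 'I_d) : lift ord_max i = i :> nat.
  by rewrite lift_max.
apply/idP/idP.
  case/and3P=> /forallP H1 /forallP H2 /forallP H3.
  have := H2 ord_max; rewrite fm => -> /=.
  have := H3 ord_max; rewrite fm eqxx /= => -> /=.
  apply/and3P; split.
  - apply/forallP => i; apply/forallP => j.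
    by have /forallP/(_ (lift ord_max j)) := H1 (lift ord_max i); rewrite !fl !lm.
  - by apply/forallP => i; have := H2 (lift ord_max i); rewrite fl lm.
  - apply/forallP => i; apply/implyP => _.
    have /forallP/(_ ord_max) := H1 (lift ord_max i).
    by rewrite fl fm lm /= ltn_ord.
case/and3P=> wx Qx /and3P[/forallP H1 /forallP H2 /forallP H3].
(* The predicate bounds only the last entry of [p]; monotonicity carries the bound over to the
   earlier ones. *)
have lastx (i : 'I_d) : p i < x.
  case: d p fm fl lm wx H1 H2 H3 i => [|d] p fm fl lm wx H1 H2 H3 i; first by case: i.
  have := H3 ord_max; rewrite eqxx /= => pmx.
  have [->//|im] := eqVneq i ord_max.
  have /forallP/(_ ord_max) := H1 i.
  have -> /= : i < d by move: im; rewrite -(inj_eq val_inj) /=; case: i => i /=; lia.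
  by move=> h; apply: (ltn_trans h).
apply/and3P; split.
- apply/forallP => i; apply/forallP => j.
  case: (unliftP ord_max i) => [i'|] ->; case: (unliftP ord_max j) => [j'|] ->.
  + by rewrite !fl !lm; have /forallP := H1 i'; apply.
  + by rewrite fl fm lastx implybT.
  + by rewrite lm /= ltnNge (ltnW (ltn_ord _)).
  + by rewrite ltnn.
- apply/forallP => i; case: (unliftP ord_max i) => [i'|] ->.
    by rewrite fl lm.
  by rewrite fm.
- apply/forallP => i; case: (unliftP ord_max i) => [i'|] ->.
    by rewrite lm eqSS ltn_eqF.
  by rewrite fm Qx implybT.
Qed.

Lemma card_chain_pred_rcons n w d (Q : pred 'I_n) :
  #|@chain_pred n w d.+1 Q| =
  \sum_(x : 'I_n) (nth 0 w x == d.+1) * Q x *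
     #|@chain_pred n w d (fun y => y < x)|.
Proof.
rewrite -sum1_card (partition_big (fun p : {ffun 'I_d.+1 -> 'I_n} => p ord_max) xpredT) //=.
apply: eq_bigr => x _.
have fm p : ffun_rcons n d x p ord_max = x by rewrite ffunE unlift_none.
rewrite (reindex_onto (ffun_rcons n d x)
          (fun p => [ffun i => p (lift ord_max i)])) /=; last first.
  move=> p /andP[_ /eqP px]; apply/ffunP => i; rewrite ffunE.
  by case: unliftP => [j|] -> //; rewrite ffunE.
transitivity (\sum_(p | [&& nth 0 w x == d.+1, Q x &
   @chain_pred n w d (fun y => y < x) p]) 1).
  apply: eq_bigl => p; rewrite -[in LHS]topredE /= chain_pred_rcons fm eqxx andbT.
  suff -> : [ffun i => ffun_rcons n d x p (lift ord_max i)] == p by rewrite andbT.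
  by apply/eqP/ffunP => i; rewrite !ffunE liftK.
case: (_ == d.+1) => /=; last by rewrite big_pred0// !mul0n.
case: (Q x) => /=; last by rewrite big_pred0// mul0n.
by rewrite !mul1n -sum1_card; apply: eq_bigl => p; rewrite -[RHS]topredE.
Qed.

Lemma card_chain_pred n w d (x : nat) : x <= n ->
  #|@chain_pred n w d (fun y => y < x)| = nchain (letter_at w) d x.
Proof.
elim: d x => [|d IH] x xn.
  rewrite /= -[RHS](_ : #|{ffun 'I_0 -> 'I_n}| = 1); last first.
    by rewrite card_ffun !card_ord expn0.
  apply: eq_card => p; rewrite -[LHS]topredE /= /chain_pred.
  by apply/and3P; split; apply/forallP; case.
rewrite card_chain_pred_rcons /= (big_ord_widen n
  (fun b => letter_at w d.+1 b * nchain (letter_at w) d b))// [RHS]big_mkcond/=.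
apply: eq_bigr => y _; rewrite IH; last exact: ltnW.
by rewrite /letter_at; case: (y < x); rewrite ?muln1// muln0.
Qed.

Lemma SfunE d w t :
  Sfun d.+1 w t = \sum_(p < size w) (nth 0 w p == d.+1) *
    (count_mem d.+1 (take p.+1 w) <= t) * nsub d (take p w).
Proof.
rewrite /Sfun (card_chain_pred_rcons (size w) w d
   (fun p => count_mem d.+1 (take p.+1 w) <= t)).
by apply: eq_bigr => p _; rewrite card_chain_pred ?nchain_take// ltnW.
Qed.

(** * Shuffles of two words *)

Lemma big_tuple_cons (A : finType) n (F : seq A -> nat) :
  \sum_(t : n.+1.-tuple A) F t = \sum_(x : A) \sum_(t : n.-tuple A) F (x :: t).
Proof.
rewrite pair_big /= (reindex (fun p : A * n.-tuple A => [tuple of p.1 :: p.2])) //=.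
exists (fun t => (thead t, [tuple of behead t])) => [[x t] _|t _] /=.
  by rewrite theadE; congr pair; apply: val_inj.
by rewrite -tuple_eta.
Qed.

Lemma big_tuple0 (A : finType) (F : seq A -> nat) :
  \sum_(t : 0.-tuple A) F t = F [::].
Proof.
rewrite (bigD1 [tuple]) //= big1 ?addn0// => t /eqP[].
exact: tuple0.
Qed.

(** A leading [i] shifts all gaps by one and leaves gap 0 empty, whereas a leading [j] falls into
    gap 0. *)
Lemma pistar_cons (A : eqType) (w : seq A) x i j r : i != j ->
  pistar (x :: w) i j r =
  if x == i then (if r is r'.+1 then pistar w i j r' else 0)
  else (x == j) * (r == 0) + pistar w i j r.
Proof.
move=> ij; rewrite /pistar /= (iotaDl 1 0) count_map.
have [->|xi] := eqVneq x i.
  rewrite (negPf ij) add0n; case: r => [|r].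
    rewrite /= -[RHS](count_pred0 (iota 0 (size w))).
    by apply: eq_count => p /=; rewrite eqxx andbF.
    by apply: eq_count => p /=; rewrite eqxx add1n eqSS.
congr (_ + _); first by case: (x == j); case: r.
by apply: eq_count => p /=; rewrite (negPf xi) add0n.
Qed.

Lemma pistar_nil (A : eqType) (i j : A) r : pistar [::] i j r = 0.
Proof. by []. Qed.

(* Number of letters [e_1, ..., e_(d-1)] between the [r]-th and the next [e_d]. *)
Definition others (d : nat) (w : seq nat) (r : nat) : nat :=
  \sum_(1 <= l < d) pistar w d l r.

Lemma others_cons d x w r : 0 < x ->
  others d (x :: w) r =
  if x == d then (if r is r'.+1 then others d w r' else 0)
  else (x < d) * (r == 0) + others d w r.
Proof.
move=> x0; rewrite /others.
rewrite (eq_big_nat _ _ (F2 := fun l => if x == d then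
    (if r is r'.+1 then pistar w d l r' else 0)
    else (x == l) * (r == 0) + pistar w d l r)); last first.
  by move=> l /andP[_ ld]; rewrite pistar_cons// gtn_eqF.
have [xd|xd] := eqVneq x d; first by  case: r => [|r] //; rewrite big1.
rewrite big_split /=; congr (_ + _).
rewrite -big_distrl /=; congr (_ * _).
have [xltd|xged] := ltnP x d.
  rewrite (big_cat_nat (n := x)) ?(ltnW xltd)//= [X in _ + X]big_ltn// eqxx.
  rewrite big_nat big1 ?add0n; last by move=> l /andP[_ lx]; rewrite gtn_eqF.
  rewrite big_nat big1 ?addn0// => l /andP[xl _].
  by rewrite ltn_eqF.
rewrite big_nat big1// => l /andP[_ ld].
by rewrite gtn_eqF// (leq_trans ld).
Qed.

Lemma others_nil d r : others d [::] r = 0.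
Proof. by rewrite /others big1. Qed.

(** This projection and the next one recover [w] and [Pi] of the theorem from a word over
    [1, ..., d.+1]; in the second, [d] is read as [false] and [d.+1] as [true]. *)
Definition restr_low (d : nat) (w : seq nat) : seq nat := [seq x <- w | x != d.+1].

Definition restr_top (d : nat) (w : seq nat) : seq bool :=
  [seq x == d.+1 | x <- w & d <= x <= d.+1].

Definition gap_binom (d : nat) (w : seq nat) (Pi : seq bool) (r : nat) : nat :=
  'C(pistar Pi false true r + others d w r, pistar Pi false true r).

Definition letters {d : nat} (w : seq 'I_d) : seq nat := [seq (val x).+1 | x <- w].

#[global] Arguments letters {d} w : simpl never.

Lemma letters_cons (d : nat) (x : 'I_d) w : letters (x :: w) = x.+1 :: letters w.
Proof. by []. Qed.

Definition is_shuffle (d : nat) (w : seq nat) (Pi : seq bool) (s : seq nat) : bool :=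
  (restr_low d s == w) && (restr_top d s == Pi).

(** The first letter of a shuffle comes from [Pi] alone if it is [d.+1], from both words if it is
    [d], and from [w] alone otherwise. *)
Lemma is_shuffle_cons d w Pi x s : x <= d.+1 ->
  is_shuffle d w Pi (x :: s) =
  if x == d.+1 then (if Pi is true :: Pi' then is_shuffle d w Pi' s else false)
  else if w is y :: w' then (x == y) &&
    (if x == d then (if Pi is false :: Pi' then is_shuffle d w' Pi' s else false)
     else is_shuffle d w' Pi s)
  else false.
Proof.
move=> xd; rewrite /is_shuffle /restr_low /restr_top /=.
have [->|xd1] := eqVneq x d.+1.
  rewrite /= leqnSn leqnn /= eqxx; case: Pi => [|[] Pi]; rewrite ?andbF//.
have xled : x <= d by rewrite -ltnS ltn_neqAle xd1.
rewrite /=; case: w => [//|y w]; rewrite eqseq_cons -andbA; congr (_ && _).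
have [xd2|xd2] := eqVneq x d.
  rewrite xd2 leqnn leqnSn /= ltn_eqF//; case: Pi => [|[] Pi]; rewrite ?andbF//.
suff -> : (d <= x) = false by [].
by apply/negbTE; rewrite -ltnNge ltn_neqAle xd2.
Qed.

Lemma gap_binom_true d Pi r : gap_binom d [::] Pi r = 1.
Proof. by rewrite /gap_binom others_nil addn0 binn. Qed.

Lemma gap_binom_top d w Pi r : gap_binom d w (true :: Pi) r.+1 = gap_binom d w Pi r.+1.
Proof. by rewrite /gap_binom !pistar_cons. Qed.

Lemma gap_binom_low d y w Pi r : 0 < y -> y < d ->
  gap_binom d (y :: w) Pi r.+1 = gap_binom d w Pi r.+1.
Proof. by move=> y0 yd; rewrite /gap_binom !others_cons// ltn_eqF// muln0. Qed.

(** Induction on the length, by the first letter of the shuffle. There is a choice only if [w]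
    starts below [d] and [Pi] with [true]; otherwise this letter is forced and gap 0 contributes the
    factor 1. *)
Lemma count_shuffles d w (Pi : seq bool) n : 0 < d ->
  all (fun x => 0 < x <= d) w -> count_mem d w = count_mem false Pi ->
  n = size w + count_mem true Pi ->
  \sum_(t : n.-tuple 'I_d.+1) is_shuffle d w Pi (letters t) =
  \prod_(r < (count_mem d w).+1) gap_binom d w Pi r.
Proof.
move=> d0; elim: n w Pi => [|n IH] w Pi.
  case: w => //= _; case: Pi => [|[] Pi]//= _ _.
  rewrite (big_tuple0 _ (fun s => is_shuffle d [::] [::] (letters s))).
  by rewrite big_ord1 gap_binom_true.
move=> wd cnt sz.
rewrite (big_tuple_cons _ _ (fun s => is_shuffle d w Pi (letters s))) big_ord_recr/=.
set low := (X in X + _ = _); set top := (X in _ + X = _).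
have topE : top = if Pi is true :: Pi' then
    \sum_(t : n.-tuple 'I_d.+1) is_shuffle d w Pi' (letters t) else 0.
  rewrite /top; under eq_bigr do rewrite letters_cons is_shuffle_cons//= eqxx.
  by case: Pi {wd cnt sz low top} => [|[] Pi] //; rewrite big1.
(* Among the letters up to [d], only the head of [w] can come first. *)
have lowE : low = if w is y :: w' then \sum_(t : n.-tuple 'I_d.+1)
    (if y == d then (if Pi is false :: Pi' then is_shuffle d w' Pi' (letters t) else false)
     else is_shuffle d w' Pi (letters t)) else 0.
  have cons_low (x : 'I_d) s : is_shuffle d w Pi (x.+1 :: s) =
      if w is y :: w' then (x.+1 == y) &&
        (if x.+1 == d then (if Pi is false :: Pi' then is_shuffle d w' Pi' s else false)
         else is_shuffle d w' Pi s)
      else false.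
    by rewrite is_shuffle_cons ?ltnS ?(ltnW (ltn_ord x))// eqSS (ltn_eqF (ltn_ord x)).
  rewrite /low; under eq_bigr => x _.
    under eq_bigr do rewrite letters_cons cons_low /=.
    over.
  case: w wd {cnt sz low top topE cons_low} => [|y w] /= wd.
    by rewrite big1// => x _; rewrite big1.
  have {wd} /andP[y0 yd] : 0 < y <= d by case/andP: wd.
  have yd' : y.-1 < d by rewrite prednK.
  rewrite (bigD1 (Ordinal yd')) //= [X in _ + X]big1 ?addn0.
    by apply: eq_bigr => t _; rewrite prednK// eqxx.
  move=> x xy; rewrite big1// => t _; case: eqP => //= xy'.
  by case/eqP: xy; apply: val_inj; rewrite /= -xy'.
rewrite lowE topE {lowE topE low top}.
case: w wd cnt sz => [|y w].
  case: Pi => [|[] Pi]//= _ cnt [sz]; rewrite add0n IH//=.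
  by rewrite !big_ord1 !gap_binom_true.
move=> /= /andP[/andP[y0 yd] wd].
have [->|yd'] := eqVneq y d.
  case: Pi => [|[] Pi]//=.
    rewrite add0n add1n => cnt sz; rewrite big1 ?add0n//.
    have dw : all (fun x => 0 < x <= d) (d :: w) by rewrite /= d0 leqnn.
    rewrite (IH _ _ dw) /= ?eqxx ?add1n//; last by move: cnt sz => /=; lia.
    rewrite big_ord_recl [RHS]big_ord_recl; congr (_ * _).
      by rewrite /gap_binom !others_cons// eqxx !addn0 !binn.
    by apply: eq_bigr => i _; rewrite gap_binom_top.
  rewrite !add1n add0n addSn => -[cnt] [sz]; rewrite addn0 IH//.
  rewrite [RHS]big_ord_recl [X in _ = X * _]/gap_binom others_cons// eqxx pistar_cons//= bin0 mul1n.
  by apply: eq_bigr => i _; rewrite /gap_binom others_cons// eqxx pistar_cons.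
rewrite add0n; case: Pi => [|[] Pi]//=.
- move=> cnt sz; rewrite addn0 IH//; last by move: cnt sz => /=; lia.
  rewrite !big_ord_recl; congr (_ * _); first by rewrite /gap_binom !pistar_nil !bin0.
  by apply: eq_bigr => i _; rewrite gap_binom_low// ltn_neqAle yd'.
(* Either word may supply the first letter. The two counts differ only in the factor of gap 0, where
   Pascal's rule adds them. *)
- rewrite add0n add1n => cnt sz; rewrite IH//; last by move: cnt sz => /=; lia.
  have yw : all (fun x => 0 < x <= d) (y :: w) by rewrite /= y0 yd.
  rewrite (IH _ _ yw) /= ?(negPf yd') ?add0n//; last by move: cnt sz => /=; lia.
  rewrite !big_ord_recl.
  have yd2 : y < d by rewrite ltn_neqAle yd'.
  have E1 i : gap_binom d (y :: w) Pi (lift ord0 i) = gap_binom d w Pi i.+1.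
    exact: gap_binom_low.
  have E2 i : gap_binom d w (true :: Pi) (lift ord0 i) = gap_binom d w Pi i.+1.
    exact: gap_binom_top.
  have E3 i : gap_binom d (y :: w) (true :: Pi) (lift ord0 i) = gap_binom d w Pi i.+1.
    exact: etrans (gap_binom_low _ _ _ _ _ y0 yd2) (gap_binom_top _ _ _ _).
  rewrite (eq_bigr _ (fun i _ => E1 _ i)) (eq_bigr _ (fun i _ => E2 _ i)).
  rewrite [in RHS](eq_bigr _ (fun i _ => E3 _ i)).
  rewrite -mulnDl; congr (_ * _).
  rewrite /gap_binom !pistar_cons//= !others_cons// (negPf yd') ltn_neqAle yd' yd /=.
  by rewrite !mul1n !add1n !addnS [RHS]binS addSn.
- move=> cnt sz; rewrite addn0 IH//; last by move: cnt sz => /=; lia.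
  rewrite !big_ord_recl; congr (_ * _); first by rewrite /gap_binom !pistar_cons// !bin0.
  by apply: eq_bigr => i _; rewrite gap_binom_low// ltn_neqAle yd'.
Qed.

(** * Subsequence counts as a dot product *)

Lemma leq_count_take (A : eqType) (p : pred A) (w : seq A) a b : a <= b ->
  count p (take a w) <= count p (take b w).
Proof.
move=> ab; rewrite -[X in _ <= count p X](cat_take_drop a) count_cat take_takel//.
exact: leq_addr.
Qed.

(** A letter [d.+1] lies in the prefix iff the number of its copies up to and including its position
    is at most their number in the prefix. This turns a bound on positions into the bound on
    occurrences used by [Sfun]. *)
Lemma nsub_take_Sfun d w p : p <= size w ->
  nsub d.+1 (take p w) = Sfun d.+1 w (count_mem d.+1 (take p w)).
Proof.
move=> pw; rewrite -nchain_take// SfunE /= (big_ord_widen (size w)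
  (fun b => letter_at w d.+1 b * nchain (letter_at w) d b))// big_mkcond /=.
apply: eq_bigr => b _; rewrite nchain_take; last exact: ltnW.
rewrite /letter_at; case: eqP => [wb|]; last by case: ifP.
rewrite !mul1n; case: ltnP => [bp|pb].
  by rewrite leq_count_take// mul1n.
rewrite (take_nth 0)// -cats1 count_cat wb /= eqxx addn0 addn1 ltnNge.
by rewrite leq_count_take.
Qed.

Lemma Sfun_rcons d w x t : Sfun d.+1 (rcons w x) t =
  Sfun d.+1 w t + (x == d.+1) * (count_mem d.+1 w < t) * nsub d w.
Proof.
rewrite !SfunE size_rcons big_ord_recr /= nth_rcons ltnn eqxx.
congr (_ + _).
  apply: eq_bigr => b _; have bw := ltn_ord b.
  by rewrite nth_rcons bw -cats1 !takel_cat// ltnW.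
rewrite take_oversize ?size_rcons// -cats1 take_size_cat// count_cat /=.
by case: eqP => //= _; rewrite addn0 addn1.
Qed.

Lemma Sfun_filter (p : pred nat) d w t :
  (forall j, 1 <= j <= d.+1 -> p j) -> Sfun d.+1 [seq x <- w | p x] t = Sfun d.+1 w t.
Proof.
move=> pd; have pd1 : forall j, 1 <= j <= d -> p j.
  by move=> j /andP[j1 jd]; apply: pd; rewrite j1 (leqW jd).
elim/last_ind: w => [//|w x IH]; rewrite filter_rcons Sfun_rcons -IH.
case: ifPn => px.
  rewrite Sfun_rcons nsub_filter// count_filter; congr (_ + _ * (_ < _) * _).
  by apply: eq_count => y /=; case: eqP => //= ->; rewrite pd//= leqnn.
by case: eqP px => [->|_ _]; rewrite ?pd ?leqnn// mul0n addn0.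
Qed.

Lemma pistar_restr_top d w r :
  pistar (restr_top d w) false true r = pistar w d d.+1 r.
Proof.
have dd1 : d != d.+1 by rewrite ltn_eqF.
elim: w r => [//|x w IH] r; rewrite pistar_cons// /restr_top /=.
have [->|xd1] := eqVneq x d.+1.
  by rewrite leqnSn leqnn /= eqxx gtn_eqF// pistar_cons//= IH.
have [->|xd] := eqVneq x d.
  by rewrite leqnn leqnSn /= ltn_eqF// pistar_cons//; case: r => [|r]; rewrite ?IH.
suff -> : (d <= x <= d.+1) = false by rewrite IH.
by apply/negbTE; move: xd xd1; lia.
Qed.

Lemma pistar_sum (A : eqType) (w : seq A) i j r x0 :
  pistar w i j r = \sum_(p < size w) (nth x0 w p == j) * (count_mem i (take p w) == r).
Proof.
rewrite /pistar -sum1_count big_mkcond -[size w in LHS]subn0 -/(index_iota _ _).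
rewrite big_mkord; apply: eq_bigr => p _.
by rewrite (set_nth_default x0)//; case: eqP; case: eqP.
Qed.

(** Subsequences are sorted by the position [p] of their last letter. If [r] letters [e_d] precede
    [p], then [S_r] counts the possible beginnings, and [pistar] counts the positions with this
    [r]. *)
Lemma nsub_dot d w : 0 < d ->
  nsub d.+1 w = \sum_(r < (count_mem d w).+1)
     Sfun d (restr_low d w) r * pistar (restr_top d w) false true r.
Proof.
case: d => // d _.
transitivity (\sum_(r < (count_mem d.+1 w).+1) \sum_(p < size w)
   Sfun d.+1 w r * ((nth 0 w p == d.+2) * (count_mem d.+1 (take p w) == r))); last first.
  apply: eq_bigr => r _; rewrite pistar_restr_top (pistar_sum _ _ _ _ _ 0) big_distrr /=.
  rewrite Sfun_filter// => j /andP[j1 jd].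
  by rewrite ltn_eqF// ltnS.
rewrite exchange_big /=; apply: eq_bigr => p _.
have pw : p <= size w by rewrite ltnW.
have cp : count_mem d.+1 (take p w) < (count_mem d.+1 w).+1.
  by rewrite ltnS -[X in _ <= count _ X](take_size w) leq_count_take.
rewrite (bigD1 (Ordinal cp)) //= eqxx muln1 [X in _ + X]big1 ?addn0; last first.
  by move=> r; rewrite -(inj_eq val_inj) /= eq_sym => /negPf ->; rewrite !muln0.
by rewrite -nsub_take_Sfun// mulnC -nchain_take.
Qed.

(** * Summation over all words through their restrictions *)

Lemma count_restr_low d w j : j <= d -> count_mem j (restr_low d w) = count_mem j w.
Proof.
move=> jd; rewrite count_filter; apply: eq_count => x /=.
by case: eqP => //= ->; rewrite ltn_eqF.
Qed.

Lemma count_restr_top d w b :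
  count_mem b (restr_top d w) = count_mem (b + d) w.
Proof.
rewrite count_map count_filter; apply: eq_count => x /=.
by case: b; rewrite ?add1n ?add0n; case: (ltngtP x d.+1) => //=; lia.
Qed.

Lemma size_restr_low d w : size (restr_low d w) + count_mem d.+1 w = size w.
Proof. by rewrite size_filter addnC count_predC. Qed.

Lemma size_restr_top d w : size (restr_top d w) = count_mem d w + count_mem d.+1 w.
Proof.
rewrite -(count_predC (pred1 false)) count_restr_top add0n; congr (_ + _).
rewrite -[d.+1]/(true + d) -count_restr_top; apply: eq_count => x; by case: x.
Qed.

Lemma count_letters d (w : seq 'I_d) (i : 'I_d) :
  count_mem i.+1 (letters w) = count_mem i w.
Proof. by rewrite count_map; apply: eq_count => x /=; rewrite eqSS. Qed.

Lemma letters_inj d : injective (@letters d).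
Proof. by apply: inj_map => x y [] /val_inj. Qed.

Lemma all_letters d (w : seq 'I_d) : all (fun x => 0 < x <= d) (letters w).
Proof. by rewrite all_map; apply/allP => x _ /=. Qed.

Lemma letters_onto d (s : seq nat) : all (fun x => 0 < x <= d) s ->
  exists w : seq 'I_d, letters w = s.
Proof.
elim: s => [|x s IH] /=; first by exists [::].
case: x => //= x /andP[xd] /IH[w <-].
by exists (Ordinal xd :: w); rewrite letters_cons.
Qed.

(** Such sums of indicators name a restriction of a word inside a sum, after which summations can be
    exchanged. *)
Lemma sum_eq_letters d n (s : seq nat) (P : pred (n.-tuple 'I_d)) :
  all (fun x => 0 < x <= d) s -> size s = n ->
  (forall w : n.-tuple 'I_d, letters w = s -> P w) ->
  \sum_(w : n.-tuple 'I_d | P w) (s == letters w) = 1.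
Proof.
move=> /letters_onto[w <-]; rewrite size_map => /eqP wn Pw.
rewrite (bigD1 (Tuple wn)) ?Pw//= eqxx big1 ?addn0// => v /andP[_ vw].
by apply/eqP; rewrite eqb0; apply: contra vw => /eqP/letters_inj vw; apply/eqP/val_inj.
Qed.

Lemma sum_eq_tuple (A : finType) n (s : seq A) (P : pred (n.-tuple A)) :
  size s = n -> (forall w : n.-tuple A, w = s :> seq A -> P w) ->
  \sum_(w : n.-tuple A | P w) (s == w) = 1.
Proof.
move=> /eqP wn Pw.
rewrite (bigD1 (Tuple wn)) ?Pw//= eqxx big1 ?addn0// => v /andP[_ vw].
by apply/eqP; rewrite eqb0; apply: contra vw => /eqP vw; apply/eqP/val_inj.
Qed.

Lemma wordsP_letters d (m : nat -> nat)
    (w : (\sum_(1 <= i < d.+1) m i).-tuple 'I_d) :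
  wordsP w = [forall i : 'I_d, count_mem i.+1 (letters w) == m i.+1].
Proof. by apply: eq_forallb => i; rewrite count_letters. Qed.

(** The numerator of the conditional probability, since words with the same letter counts are
    equally likely. *)
Definition good_words (q : nat) (m : nat -> nat) (n : nat) : nat :=
  \sum_(t : (\sum_(1 <= i < q.+1) m i).-tuple 'I_q | wordsP t)
     (nsub q (letters t) == n).

Lemma wordsP_top d (m : nat -> nat) (w : (\sum_(1 <= i < d.+2) m i).-tuple 'I_d.+1) :
  0 < d -> wordsP w -> count_mem d (letters w) = m d /\ count_mem d.+1 (letters w) = m d.+1.
Proof.
rewrite wordsP_letters => d0 /forallP wP; split; last exact/eqP/(wP ord_max).
have dd : d.-1 < d.+1 by rewrite prednK.
by have := wP (Ordinal dd); rewrite /= prednK// => /eqP.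
Qed.

Lemma wordsAB_count a b (Pi : (a + b).-tuple bool) : wordsAB Pi ->
  count_mem false Pi = a /\ count_mem true Pi = b.
Proof.
move=> /eqP Pib; split => //; apply/eqP; rewrite -(eqn_add2r b) -{2}Pib.
rewrite -[X in _ == X](size_tuple Pi) -(count_predC (pred1 true)) addnC; apply/eqP.
by congr (_ + _); apply: eq_count => -[].
Qed.

(** Every word with the prescribed counts is a shuffle of exactly one admissible pair, its two
    restrictions, and [nsub_dot] reads its number of subsequences off that pair. *)
Lemma sum_words_shuffles d (m : nat -> nat) n : 0 < d ->
  \sum_(w : (\sum_(1 <= i < d.+1) m i).-tuple 'I_d | wordsP w)
    \sum_(Pi : (m d + m d.+1).-tuple bool | wordsAB Pi &&
        ((\sum_(r < (m d).+1) Sfun d (word_letters w) r * pistar Pi false true r) == n))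
      \prod_(r < (m d).+1) gap_binom d (word_letters w) Pi r =
  good_words d.+1 m n.
Proof.
move=> d0; set M := \sum_(1 <= i < d.+2) m i.
have ME : M = \sum_(1 <= i < d.+1) m i + m d.+1 by rewrite /M big_nat_recr.
(* The product of gap binomials becomes a number of shuffles [t], and the condition on the dot
   product moves to [t]. *)
transitivity (\sum_(w : (\sum_(1 <= i < d.+1) m i).-tuple 'I_d | wordsP w)
    \sum_(Pi : (m d + m d.+1).-tuple bool | wordsAB Pi)
      \sum_(t : M.-tuple 'I_d.+1) is_shuffle d (letters w) Pi (letters t) *
         (nsub d.+1 (letters t) == n)).
  apply: eq_bigr => w wP; rewrite big_mkcondr; apply: eq_bigr => Pi PiP.
  have [PF PT] := wordsAB_count _ _ _ PiP.
  have wd : count_mem d (letters w) = m d.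
    case: d d0 w wP {Pi PiP M ME PF PT} => // d _ w wP.
    by move: wP; rewrite wordsP_letters => /forallP/(_ ord_max)/eqP.
  rewrite -[word_letters w]/(letters w).
  move: (tval Pi) PF PT => {PiP} s PF PT.
  rewrite -wd -(count_shuffles _ _ _ M)//; first last.
  - by rewrite size_map size_tuple PT.
  - by rewrite wd PF.
  - exact: all_letters.
  transitivity (\sum_(t : M.-tuple 'I_d.+1) is_shuffle d (letters w) s (letters t) *
     (\sum_(r < (count_mem d (letters w)).+1)
        Sfun d (letters w) r * pistar s false true r == n)).
    by rewrite -big_distrl /=; case: eqP; rewrite ?muln1 ?muln0.
  apply: eq_bigr => t _; rewrite /is_shuffle.
  case: eqP => //= tw; case: eqP => //= ts.
  by rewrite nsub_dot// -tw -ts count_restr_low.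
transitivity (\sum_(t : M.-tuple 'I_d.+1)
    (\sum_(w : (\sum_(1 <= i < d.+1) m i).-tuple 'I_d | wordsP w)
      (restr_low d (letters t) == letters w) *
      (\sum_(Pi : (m d + m d.+1).-tuple bool | wordsAB Pi)
        (restr_top d (letters t) == Pi))) * (nsub d.+1 (letters t) == n)).
  under [RHS]eq_bigr => t _.
    rewrite big_distrl.
    under eq_bigr => w _.
      rewrite big_distrr big_distrl /=.
      over.
    over.
  rewrite [RHS]exchange_big; apply: eq_bigr => w _.
  rewrite [RHS]exchange_big; apply: eq_bigr => Pi _.
  by apply: eq_bigr => t _; rewrite /is_shuffle -mulnb.
rewrite /good_words -/M [RHS]big_mkcond; apply: eq_bigr => t _.
case: ifPn => tP.
  have [td td1] := wordsP_top _ _ _ d0 tP.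
  move: tP; rewrite wordsP_letters => /forallP tP.
  rewrite -big_distrl sum_eq_letters /=; first last.
  - move=> w ww; rewrite wordsP_letters; apply/forallP => i.
    rewrite ww count_restr_low//; exact: (tP (widen_ord (leqnSn d) i)).
  - apply/eqP; rewrite -(eqn_add2r (m d.+1)) -ME -{1}td1 size_restr_low size_map.
    by rewrite size_tuple.
  - apply/allP => x; rewrite mem_filter => /andP[xd] /(allP (all_letters _ _)).
    by rewrite [x <= d.+1]leq_eqVlt (negPf xd) ltnS.
  rewrite sum_eq_tuple ?mul1n//.
    by rewrite size_restr_top td td1.
  by move=> Pi Pit; rewrite /wordsAB Pit count_restr_top td1.
(* A word [t] with wrong counts has no admissible pair, because its restrictions determine all its
   counts. *)
rewrite big1// => w wP.
case: eqP => //= tw; rewrite mul1n big1// => Pi PiP.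
case: eqP => //= tPi; exfalso; move: tP; apply/negP; rewrite negbK.
rewrite wordsP_letters; apply/forallP => i; case: (unliftP ord_max i) => [j|] ->.
  rewrite lift_max -(count_restr_low d)// tw.
  by move: wP; rewrite wordsP_letters => /forallP.
by rewrite -[_.+1]/(true + d) -count_restr_top tPi.
Qed.

(** Fixing the first letter [x] lowers [c x] by one and splits a factor [c x] off the factorials;
    these factors add up to the length. *)
Lemma count_words q n (c : 'I_q -> nat) : \sum_i c i = n ->
  (\sum_(t : n.-tuple 'I_q) [forall i, count_mem i t == c i]) * \prod_i (c i)`! = n`!.
Proof.
elim: n c => [|n IH] c cn.
  have c0 i : c i = 0.
    by apply/eqP; rewrite -leqn0 -cn (bigD1 i) //= leq_addr.
  rewrite [X in _ * X]big1 ?muln1; last by move=> i _; rewrite c0.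
  rewrite (big_tuple0 _ (fun t => [forall i, count_mem i t == c i])).
  by apply/eqP; rewrite eqb1; apply/forallP => i; rewrite c0.
rewrite (big_tuple_cons _ _ (fun t => [forall i, count_mem i t == c i])).
rewrite big_distrl /= factS -cn big_distrl /=; apply: eq_bigr => x _.
have [cx|cx] := posnP (c x).
  rewrite cx mul0n big1 ?mul0n// => t _; apply/eqP; rewrite eqb0.
  by apply/forallPn; exists x; rewrite cx eqxx.
rewrite -(IH (fun i => c i - (x == i))); last first.
  apply/eqP; rewrite -eqSS -cn (bigD1 x)//= [in X in _ == X](bigD1 x)//= eqxx subn1.
  rewrite -addSn prednK// eqn_add2l; apply/eqP; apply: eq_bigr => i xi.
  by rewrite eq_sym (negPf xi) subn0.
rewrite mulnCA; congr (_ * _).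
  apply: eq_bigr => t _; congr (nat_of_bool _); apply: eq_forallb => i.
  rewrite /=; have [<-|_] := eqVneq x i; last by rewrite add0n subn0.
  by rewrite add1n subn1 -{1}(prednK cx) eqSS.
rewrite (bigD1 x)//= [in RHS](bigD1 x)//= eqxx subn1 mulnA.
rewrite -{1}(prednK cx) factS prednK//; congr (_ * _).
by apply: eq_bigr => i xi; rewrite eq_sym (negPf xi) subn0.
Qed.

(** [count_words] shows that the division in [multinom] is exact. *)
Lemma multinomE q m :
  \sum_(t : (\sum_(1 <= i < q.+1) m i).-tuple 'I_q | wordsP t) 1 = multinom q m.
Proof.
rewrite /multinom -(count_words q _ (fun i : 'I_q => m i.+1)); last first.
  by rewrite big_add1 /= big_mkord.
rewrite [X in _ %/ X]big_add1 /= big_mkord mulnK ?big_mkcond//.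
by apply/prodn_gt0 => i; exact: fact_gt0.
Qed.

(** * Words with blanks *)

Definition vals {d : nat} (w : seq 'I_d) : seq nat := [seq val x | x <- w].
#[global] Arguments vals {d} w : simpl never.

(* In words with blanks the letter [0] marks an offset cell without a point. *)
Definition unblank (w : seq nat) : seq nat := [seq x <- w | x != 0].

(** A filling amounts to a choice of the nonblank cells. In the induction the first cell is blank or
    carries the head of [s], which is Pascal's rule. *)
Lemma count_unblank q n (s : seq nat) : all (fun x => 0 < x <= q) s ->
  \sum_(t : n.-tuple 'I_q.+1) (unblank (vals t) == s) = 'C(n, size s).
Proof.
elim: n s => [|n IH] s sq.
  rewrite (big_tuple0 _ (fun t => unblank (vals t) == s)).
  by case: s {sq}.
rewrite (big_tuple_cons _ _ (fun t => unblank (vals t) == s)) big_ord_recl /=.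
rewrite [X in X + _](_ : _ = 'C(n, size s)); last by rewrite -IH.
case: s sq => [|y s] /= => [_|/andP[/andP[y0 yq] sq]].
  by rewrite bin0 big1// => x _; rewrite big1.
have yq' : y.-1 < q by rewrite prednK.
rewrite (bigD1 (Ordinal yq')) //= [X in _ + (_ + X)]big1 ?addn0; last first.
  move=> x xy; rewrite big1// => t _; apply/eqP; rewrite eqb0; apply: contra xy.
  rewrite [unblank _]/= eqseq_cons => /andP[/eqP xy _]; apply/eqP/val_inj => /=.
  by rewrite -xy.
rewrite binS; congr (_ + _); rewrite -IH//; apply: eq_bigr => t _.
rewrite [unblank _]/= eqseq_cons /= [X in (X == _) && _](_ : _ = y) ?eqxx//.
by rewrite /bump /= add1n prednK.
Qed.

Definition profile (q : nat) (m : nat -> nat) (w : seq nat) : bool :=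
  [forall i : 'I_q, count_mem i.+1 w == m i.+1].

Lemma sum_count_mem_ord q (w : seq 'I_q) : \sum_i count_mem i w = size w.
Proof.
elim: w => [|x w IH] /=; first by rewrite big1.
rewrite big_split /= IH (bigD1 x)//= eqxx big1 ?addn0// => i.
by rewrite eq_sym => /negPf ->.
Qed.

(** Blanks change neither the counts of the letters [1, ..., q] nor [nsub], so each word occurs once
    for every choice of its nonblank cells. *)
Lemma sum_blank_words q n (m : nat -> nat) (f : nat -> nat) :
  \sum_(t : n.-tuple 'I_q.+1 | profile q m (vals t)) f (nsub q (vals t)) =
  'C(n, \sum_(1 <= i < q.+1) m i) *
    \sum_(w : (\sum_(1 <= i < q.+1) m i).-tuple 'I_q | wordsP w) f (nsub q (letters w)).
Proof.
set M := \sum_(1 <= i < q.+1) m i.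
have unblank_letters (w : seq 'I_q.+1) : all (fun x => 0 < x <= q) (unblank (vals w)).
  apply/allP => x; rewrite mem_filter lt0n => /andP[-> /mapP[i _ ->]].
  by rewrite /= -ltnS ltn_ord.
have unblank_count w (i : 'I_q) : count_mem i.+1 (unblank w) = count_mem i.+1 w.
  by rewrite count_filter; apply: eq_count => x /=; case: eqP => // ->.
have nsub_unblank w : nsub q (unblank w) = nsub q w.
  by apply: nsub_filter => -[|j].
transitivity (\sum_(t : n.-tuple 'I_q.+1) \sum_(w : M.-tuple 'I_q | wordsP w)
    (unblank (vals t) == letters w) * f (nsub q (letters w))); last first.
  rewrite exchange_big /= big_distrr /=; apply: eq_bigr => w wP.
  by rewrite -big_distrl /= count_unblank ?all_letters// size_map size_tuple.
rewrite big_mkcond; apply: eq_bigr => t _; case: ifPn => tP.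
  transitivity (\sum_(w : M.-tuple 'I_q | wordsP w)
      (unblank (vals t) == letters w) * f (nsub q (vals t))); last first.
    by apply: eq_bigr => w wP; case: eqP => // <-; rewrite nsub_unblank.
  rewrite -big_distrl /= sum_eq_letters ?mul1n//.
    have [w wE] := letters_onto _ _ (unblank_letters t).
    rewrite -wE size_map -sum_count_mem_ord /M big_add1 /= big_mkord.
    apply: eq_bigr => i _; rewrite -count_letters wE unblank_count.
    by move/forallP/(_ i)/eqP: tP.
  move=> w wE; rewrite wordsP_letters wE; apply/forallP => i.
  by rewrite unblank_count; move/forallP: tP.
rewrite big1// => w wP; case: eqP => // tw; exfalso; move: tP; apply/negP; rewrite negbK.
apply/forallP => i; rewrite -unblank_count tw.
by move: wP; rewrite wordsP_letters => /forallP.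
Qed.

(** * Paths and lenses *)

(** Injectivity leaves at most one point satisfying [p] in each cell, so a sum over points becomes a
    sum over occupied cells. *)
Lemma sum_cells (A : eqType) (V : seq A) (p : pred A) (c : A -> nat) (F : nat -> nat) b :
  uniq V -> {in [pred x | (x \in V) && p x] &, injective c} ->
  \sum_(x <- V | p x && (c x < b)) F (c x) =
  \sum_(a < b) has (fun x => p x && (c x == a)) V * F a.
Proof.
elim: V => [|x V IH] /=; first by rewrite big_nil big1.
case/andP=> xV uV cinj; rewrite big_cons IH//; last first.
  move=> y z /andP[yV py] /andP[zV pz]; apply: cinj; rewrite inE in_cons.
    by rewrite yV orbT.
  by rewrite zV orbT.
have [px|px] := boolP (p x) => //=.
have notV : has (fun y => p y && (c y == c x)) V = false.
  apply/hasPn => y yV; apply/negP => /andP[py /eqP cyx].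
  have yx : y = x by apply: cinj => //; rewrite inE in_cons ?eqxx ?yV ?orbT.
  by rewrite yx (negPf xV) in yV.
have neq a : a != c x -> (c x == a) || has (fun y => p y && (c y == a)) V =
    has (fun y => p y && (c y == a)) V by rewrite eq_sym => /negPf ->.
case: ifPn => cxb.
  rewrite (bigD1 (Ordinal cxb))//= notV mul0n add0n.
  rewrite [RHS](bigD1 (Ordinal cxb))//= eqxx mul1n; congr (_ + _).
  by apply: eq_bigr => a ax; rewrite neq.
apply: eq_bigr => a _; rewrite neq//; apply: contra cxb => /eqP <-.
exact: ltn_ord.
Qed.

Local Open Scope classical_set_scope.
Local Open Scope ring_scope.

Definition offset {R : realType} (r0 : R) (j : nat) (x : R) : R := j%:R * r0 - x.

Lemma lensE (R : realType) (q j : nat) (r0 x : R) : (j <= q.+1)%N ->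
  `[< lens q.+1 j r0 x >] = (0 < offset r0 j x < q.+1%:R * r0 - 1).
Proof.
move=> jq; rewrite /lens /offset natrB// set_itvE /=.
apply/asboolP/idP => [/andP[h1 h2]|/andP[h1 h2]]; apply/andP; split; lra.
Qed.

Lemma walks_from0S (R : realType) (V : seq R) (r0 y : R) i :
  walks_from0 V r0 i.+1 y = (\sum_(x <- V) walks_from0 V r0 i x * adj r0 x y)%N.
Proof. by []. Qed.

Lemma walks_from0_pred (R : realType) (V : seq R) (r0 y : R) i :
  (0 < walks_from0 V r0 i.+1 y)%N ->
  exists2 x, (0 < walks_from0 V r0 i x)%N & adj r0 x y.
Proof.
rewrite walks_from0S lt0n sum_nat_seq_neq0 => /hasP[x _].
by rewrite /= -lt0n muln_gt0 lt0b => /andP[wx xy]; exists x.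
Qed.

(** Each hop advances by less than [r0], and there is at least one hop, whence the strict bound. *)
Lemma walks_from0_lt (R : realType) (V : seq R) (r0 x : R) i :
  walks_from0 V r0 i.+1 x != 0%N -> x < i.+1%:R * r0.
Proof.
rewrite -lt0n; elim: i x => [|i IH] x /walks_from0_pred[y].
  rewrite lt0b => /eqP -> /andP[_]; rewrite sub0r normrN mul1r.
  by apply: le_lt_trans; exact: ler_norm.
move=> /IH yi /andP[_ yx].
have := ler_norm (x - y); rewrite distrC -[i.+2]addn1 natrD; lra.
Qed.

(** The offset grows by [r0 - (y - x)] from [x] to [y], so adjacency means an increase of the
    offset, and the bound on [y] then forces [x] into lens [i]. This bound is not strict so as to
    include [y = 1] for [i = q]. *)
Lemma walks_from0_step (R : realType) (V : seq R) (r0 y : R) (q i : nat) :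
  q%:R * r0 < 1 -> (0 < i <= q)%N -> offset r0 i.+1 y <= q.+1%:R * r0 - 1 ->
  walks_from0 V r0 i.+1 y =
  (\sum_(x <- V | `[< lens q.+1 i r0 x >] && (offset r0 i x < offset r0 i.+1 y)%R)
     walks_from0 V r0 i x)%N.
Proof.
move=> qr /andP[i0 iq] yl; rewrite walks_from0S [RHS]big_mkcond; apply: eq_bigr => x _.
rewrite lensE ?(leqW iq)//.
have [->|/eqP wx] := eqVneq (walks_from0 V r0 i x) 0%N; first by rewrite mul0n if_same.
have xi : x < i%:R * r0.
  by move/eqP: wx; case: i i0 {iq yl} => // i _; exact: walks_from0_lt.
rewrite /adj; move: yl; rewrite /offset -[i.+1]addn1 -[q.+1]addn1 !natrD => yl.
(* The offset bound gives [y >= i r0 + (1 - q r0)], which exceeds [i r0]. *)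
have xy : x < y by lra.
rewrite lt_eqF//= ltr0_norm ?subr_lt0//.
case: ltP => [h|h]; last by rewrite muln0; case: ifP => // /andP[_ h2]; exfalso; lra.
rewrite muln1; case: ifPn => // /negP[]; apply/andP; split; first (apply/andP; split); lra.
Qed.

Lemma walks_from0_1 (R : realType) (V : seq R) (r0 y : R) :
  uniq V -> 0 \in V -> 0 < y < r0 -> walks_from0 V r0 1 y = 1%N.
Proof.
move=> uV V0 /andP[y0 yr]; rewrite walks_from0S (bigD1_seq 0)//= eqxx big1.
  by rewrite /adj sub0r normrN gtr0_norm// yr lt_eqF.
by move=> x /negPf ->.
Qed.

(** The numbering [c] is abstract: it has to order the lens points as their offsets do, within and
    across lenses. *)
Lemma walks_from0_nchain (R : realType) (V : seq R) (r0 : R) (q n : nat)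
    (c : nat -> R -> nat) :
  (0 < q)%N -> q%:R * r0 < 1 -> 1 < q.+1%:R * r0 -> uniq V -> 0 \in V ->
  (forall i x, (0 < i <= q)%N -> x \in V -> lens q.+1 i r0 x -> (c i x < n)%N) ->
  (forall i j x y, (0 < i <= q)%N -> (0 < j <= q)%N -> x \in V -> y \in V ->
     lens q.+1 i r0 x -> lens q.+1 j r0 y ->
     (c i x < c j y)%N = (offset r0 i x < offset r0 j y)) ->
  walks_from0 V r0 q.+1 1 =
  nchain (fun i a => has (fun x => `[< lens q.+1 i r0 x >] && (c i x == a)) V) q n.
Proof.
move=> q0 qr1 qr uV V0 cn cmono; set occ := fun i a => _.
have inj i : (0 < i <= q)%N ->
    {in [pred x | (x \in V) && `[< lens q.+1 i r0 x >]] &, injective (c i)}.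
  move=> iq x y /andP[xV /asboolP xl] /andP[yV /asboolP yl] cxy.
  have := cmono i i x y iq iq xV yV xl yl; have := cmono i i y x iq iq yV xV yl xl.
  rewrite cxy ltnn /offset => /esym/negbT; rewrite -leNgt => h1.
  by move=> /esym/negbT; rewrite -leNgt => h2; lra.
(* This serves both a lens point, with [b] its own cell, and the endpoint 1, with [b = n]. *)
have step i b y : (0 < i <= q)%N -> offset r0 i.+1 y <= q.+1%:R * r0 - 1 ->
    (forall x, x \in V -> lens q.+1 i r0 x -> walks_from0 V r0 i x = nchain occ i.-1 (c i x)) ->
    (forall x, x \in V -> lens q.+1 i r0 x -> (c i x < b)%N = (offset r0 i x < offset r0 i.+1 y)) ->
    walks_from0 V r0 i.+1 y = nchain occ i b.
  move=> iq yl wx cb; rewrite (walks_from0_step _ _ _ _ q)//.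
  case: i iq yl wx cb => // i iq yl wx cb.
  rewrite [RHS]/= -sum_cells//; last exact: inj.
  rewrite [LHS]big_seq_cond [RHS]big_seq_cond; apply: congr_big => // x.
    case xV : (x \in V) => //; case xl : `[< lens _ _ _ _ >] => //=.
    by rewrite cb//; exact/asboolP.
  by move=> /and3P[xV /asboolP xl _]; rewrite wx.
have walks_lens i y : (i < q)%N -> y \in V -> lens q.+1 i.+1 r0 y ->
    walks_from0 V r0 i.+1 y = nchain occ i (c i.+1 y).
  elim: i y => [|i IH] y iq yV yl.
    move/asboolP: (yl); rewrite lensE// /offset mul1r -[q.+1]addn1 natrD => /andP[h1 h2].
    by rewrite walks_from0_1//; apply/andP; split; lra.
  apply: step => [||x xV xl|x xV xl].
  - by rewrite /= ltnW.
  - by move/asboolP: (yl); rewrite lensE ?ltnS 1?ltnW// => /andP[_ /ltW].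
  - by apply: IH => //; exact: ltnW.
  - by apply: cmono => //=; exact: ltnW.
(* For the index [q.+1] the vertex 1 has offset [(q+1) r0 - 1], the upper end of the range, so every
   point of the last lens has a smaller offset. *)
apply: step => [|||x xV xl].
- by rewrite q0 leqnn.
- by rewrite /offset.
- by case: (q) q0 walks_lens => // p _ h x xV xl; exact: h.
- rewrite cn// ?q0 ?leqnn//; move/asboolP: (xl); rewrite lensE// => /andP[_].
  by rewrite /offset => ->.
Qed.

(** * Partition of the offset range into cells *)

Definition cell_index {R : realType} (q : nat) (r0 : R) (n j : nat) (x : R) : nat :=
  Num.truncn (offset r0 j x / (q.+1%:R * r0 - 1) * n%:R).

Definition cell {R : realType} (q : nat) (r0 : R) (n j a : nat) : set R :=
  [set x | lens q.+1 j r0 x /\ cell_index q r0 n j x = a]%classic.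

(** Equal offsets may share a cell, so every configuration, even with coinciding offsets, is
    separated by all fine enough partitions. *)
Definition separated {R : realType} (q : nat) (r0 : R) (n : nat) (s : seq R) : Prop :=
  forall i j x y, (0 < i <= q)%N -> (0 < j <= q)%N -> x \in s -> y \in s ->
    lens q.+1 i r0 x -> lens q.+1 j r0 y ->
    cell_index q r0 n i x = cell_index q r0 n j y -> offset r0 i x = offset r0 j y.

Definition occupied {R : realType} (q : nat) (r0 : R) (n : nat) (s : seq R)
    (j a : nat) : bool := (0 < npts (cell q r0 n j a) s)%N.

Lemma cell_index_lt (R : realType) (q : nat) (r0 : R) n j x : 1 < q.+1%:R * r0 ->
  (j <= q)%N -> (0 < n)%N -> lens q.+1 j r0 x -> (cell_index q r0 n j x < n)%N.
Proof.
move=> qr jq n0 /asboolP; rewrite lensE ?(leqW jq)// => /andP[x0 xL].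
have L0 : 0 < q.+1%:R * r0 - 1 by rewrite subr_gt0.
rewrite truncn_lt_nat; last by rewrite mulr_ge0// divr_ge0 ?ltW.
by rewrite -[ltRHS]mul1r ltr_pM2r ?ltr0n// ltr_pdivrMr// mul1r.
Qed.

Lemma sigma_k_nchain (R : realType) (q : nat) (r0 : R) (n : nat) (s : seq R) :
  (0 < q)%N -> q%:R * r0 < 1 -> 1 < q.+1%:R * r0 -> (0 < n)%N ->
  separated q r0 n s ->
  sigma_k q.+1 r0 s = nchain (occupied q r0 n s) q n.
Proof.
move=> q0 qr1 qr n0 sep.
have r00 : 0 < r0 by have := ltr0Sn R q; nra.
(* The endpoints 0 and 1 lie in no lens. *)
have in_s i x : (0 < i <= q)%N -> x \in vertices s -> lens q.+1 i r0 x -> x \in s.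
  move=> /andP[i0 iq] + /asboolP; rewrite lensE ?(leqW iq)// /offset.
  have i1 : 1 <= i%:R :> R by rewrite ler1n.
  have iqR : i%:R <= q%:R :> R by rewrite ler_nat.
  rewrite -[q.+1]addn1 natrD mem_undup !inE => /or3P[/eqP -> |/eqP -> |//] /andP[h1 h2].
    by exfalso; nra.
  by exfalso; nra.
rewrite /sigma_k (walks_from0_nchain _ _ _ q n (cell_index q r0 n))//.
- apply: eq_nchain => j a jq _; rewrite /occupied /npts -has_count.
  apply/hasP/hasP => -[x xV].
    move=> /andP[/asboolP xl /eqP xa]; exists x; first exact: in_s xl.
    by apply/asboolP.
  move=> /asboolP[xl xa]; exists x; first by rewrite mem_undup !inE xV !orbT.
  by apply/andP; split; [exact/asboolP|exact/eqP].
- exact: undup_uniq.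
- by rewrite mem_undup inE eqxx.
- by move=> i x /andP[_ iq] _; exact: cell_index_lt.
move=> i j x y iq jq xV yV xl yl.
have xs := in_s _ _ iq xV xl; have ys := in_s _ _ jq yV yl.
have L0 : 0 < q.+1%:R * r0 - 1 by rewrite subr_gt0.
have mono u v : u <= v -> (Num.truncn (u / (q.+1%:R * r0 - 1) * n%:R) <=
    Num.truncn (v / (q.+1%:R * r0 - 1) * n%:R))%N.
  by move=> uv; apply: le_truncn; rewrite ler_wpM2r// ler_wpM2r// invr_ge0 ltW.
apply/idP/idP => [|oxy].
  by apply: contraTT; rewrite -leNgt -leqNgt; exact: mono.
rewrite ltn_neqAle mono ?ltW// andbT; apply/eqP => /(sep _ _ _ _ iq jq xs ys xl yl).
by move: oxy => /[swap] ->; rewrite ltxx.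
Qed.

(** If [u] and [v] differ, the hypothesis on [n] makes the cell length [L / n] smaller than their
    distance. *)
Lemma truncn_scale_inj (R : realType) (L u v : R) (n : nat) : 0 < L ->
  0 <= u -> 0 <= v -> (Num.truncn (L / `|u - v|)%R < n)%N ->
  Num.truncn (u / L * n%:R) = Num.truncn (v / L * n%:R) -> u = v.
Proof.
move=> L0 u0 v0 ln uv; apply/eqP; rewrite -subr_eq0 -normr_eq0; apply: contraT => d0.
have {}d0 : 0 < `|u - v| by rewrite lt_neqAle eq_sym d0 normr_ge0.
have n0 : 0 < n%:R :> R by rewrite ltr0n (leq_ltn_trans _ ln).
have := truncn_itv (mulr_ge0 (divr_ge0 u0 (ltW L0)) (ltW n0)).
have := truncn_itv (mulr_ge0 (divr_ge0 v0 (ltW L0)) (ltW n0)).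
rewrite uv; set t := Num.truncn _; rewrite -natr1 => /andP[h1 h2] /andP[h3 h4].
have : `|u / L * n%:R - v / L * n%:R| < 1 by rewrite ltr_norml; apply/andP; split; lra.
rewrite -!mulrBl !normrM normfV (gtr0_norm L0) (gtr0_norm n0) mulrAC.
rewrite ltr_pdivrMr// mul1r mulrC -ltr_pdivlMr// => h.
have := truncnS_gt (L / `|u - v|).
have : (Num.truncn (L / `|u - v|)).+1%:R <= n%:R :> R by rewrite ler_nat.
lra.
Qed.

Lemma eventually_separated (R : realType) (q : nat) (r0 : R) (s : seq R) :
  1 < q.+1%:R * r0 -> exists n0, forall n, (n0 <= n)%N -> separated q r0 n s.
Proof.
move=> qr; have L0 : 0 < q.+1%:R * r0 - 1 by rewrite subr_gt0.
set L := q.+1%:R * r0 - 1 in L0.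
pose g i j x y := (Num.truncn (L / `|offset r0 i x - offset r0 j y|)).+1.
(* The sum of the finitely many thresholds dominates each of them. *)
exists (\sum_(i < q.+1) \sum_(j < q.+1) \sum_(x <- s) \sum_(y <- s) g i j x y)%N.
move=> n gn i j x y /andP[_ iq] /andP[_ jq] xs ys /asboolP xl /asboolP yl.
move: xl yl; rewrite !lensE ?(leqW iq) ?(leqW jq)// => /andP[x0 _] /andP[y0 _].
apply: truncn_scale_inj => //; [exact: ltW|exact: ltW|].
apply: leq_trans gn; rewrite -/(g i j x y).
rewrite -ltnS in iq; rewrite -ltnS in jq.
rewrite (bigD1 (Ordinal iq))//= (bigD1 (Ordinal jq))//=.
rewrite -!addnA; apply: leq_trans (leq_addr _ _).
rewrite (big_rem x)//= (big_rem y)//= -addnA; exact: leq_addr.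
Qed.

Lemma npts_lens (R : realType) (q : nat) (r0 : R) n j s : 1 < q.+1%:R * r0 ->
  (j <= q)%N -> (0 < n)%N ->
  npts (lens q.+1 j r0) s = (\sum_(a < n) npts (cell q r0 n j a) s)%N.
Proof.
move=> qr jq n0; elim: s => [|x s IH] /=; first by rewrite big1.
rewrite big_split /= -IH; congr (_ + _)%N.
have [xl|xl] := pselect (lens q.+1 j r0 x); last first.
  rewrite asboolF// big1// => a _; rewrite asboolF//.
  by rewrite /cell /= => -[].
rewrite asboolT//.
have ax := cell_index_lt _ _ _ _ _ _ qr jq n0 xl.
rewrite (bigD1 (Ordinal ax))//= asboolT// big1// => a aa.
rewrite asboolF// => -[_ xa]; move/eqP: aa; apply; exact/val_inj.
Qed.

Lemma count_le1_inj (A : eqType) (p : pred A) (s : seq A) x y :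
  (count p s <= 1)%N -> x \in s -> y \in s -> p x -> p y -> x = y.
Proof.
rewrite -size_filter => sz xs ys px py.
have : x \in [seq z <- s | p z] by rewrite mem_filter px.
have : y \in [seq z <- s | p z] by rewrite mem_filter py.
by case: [seq z <- s | p z] sz => [|z [|//]]//= _; rewrite !inE => /eqP -> /eqP ->.
Qed.

(** The coerced equality asks for one point in the lens named by the letter and for none in the
    others; a blank 0 leaves the offset cell empty in all lenses. *)
Definition cells_spell {R : realType} (q : nat) (r0 : R) (w : seq nat) (s : seq R) : Prop :=
  forall j a, (0 < j <= q)%N -> (a < size w)%N ->
    npts (cell q r0 (size w) j a) s = (nth 0%N w a == j).

(** Two lens points with the same cell index both lie in the lens named by the letter, whose cell
    holds a single point. *)
Lemma cells_spell_separated (R : realType) (q : nat) (r0 : R) w s :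
  1 < q.+1%:R * r0 -> (0 < size w)%N ->
  cells_spell q r0 w s -> separated q r0 (size w) s.
Proof.
move=> qr w0 ws i j x y iq jq xs ys xl yl cxy.
have [_ iq'] := andP iq.
have ax := cell_index_lt _ _ _ _ _ _ qr iq' w0 xl.
have cx : `[< cell q r0 (size w) i (cell_index q r0 (size w) i x) x >] by apply/asboolP.
have cy : `[< cell q r0 (size w) j (cell_index q r0 (size w) i x) y >] by apply/asboolP.
have := ws i _ iq ax; have := ws j _ jq ax.
case: eqP => [wj|_]; last first.
  move/eqP; rewrite -leqn0 leqNgt -has_count => /hasP[]; by exists y.
case: eqP => [wi|_ _]; last first.
  move/eqP; rewrite -leqn0 leqNgt -has_count => /hasP[]; by exists x.
move: wj; rewrite wi => ij _ c1; rewrite -ij in cy *; congr (_ - _).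
have c2 : (npts (cell q r0 (size w) i (cell_index q r0 (size w) i x)) s <= 1)%N.
  by rewrite c1.
exact: (count_le1_inj _ _ _ _ _ c2 xs ys cx cy).
Qed.

Lemma sigma_k_spell (R : realType) (q : nat) (r0 : R) w s :
  (0 < q)%N -> q%:R * r0 < 1 -> 1 < q.+1%:R * r0 -> (0 < size w)%N ->
  cells_spell q r0 w s -> sigma_k q.+1 r0 s = nsub q w.
Proof.
move=> q0 qr1 qr w0 ws; rewrite (sigma_k_nchain _ _ _ (size w))//; last first.
  exact: cells_spell_separated.
by apply: eq_nchain => j a jq aw; rewrite /occupied ws// lt0b.
Qed.

Lemma npts_lens_spell (R : realType) (q : nat) (r0 : R) w s j :
  1 < q.+1%:R * r0 -> (0 < size w)%N -> (0 < j <= q)%N ->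
  cells_spell q r0 w s -> npts (lens q.+1 j r0) s = count_mem j w.
Proof.
move=> qr w0 jq ws; rewrite (npts_lens _ _ _ (size w))//; last by case/andP: jq.
rewrite -sum1_count [RHS](big_nth 0%N) [RHS]big_mkcond [RHS]big_mkord.
by apply: eq_bigr => a _; rewrite ws//=; case: eqP.
Qed.

(** * Probabilities *)

(* The leftmost offset cell is open because the lens excludes offset [0]. *)
Lemma cell_itv (R : realType) (q : nat) (r0 : R) n j a :
  1 < q.+1%:R * r0 -> (j <= q)%N -> (a < n)%N ->
  let step := (q.+1%:R * r0 - 1) / n%:R in
  cell q r0 n j a =
  [set` Interval (BRight (j%:R * r0 - a.+1%:R * step))
                 (BSide (a == 0)%N (j%:R * r0 - a%:R * step))].
Proof.
move=> qr jq an /=; have L0 : 0 < q.+1%:R * r0 - 1 by rewrite subr_gt0.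
set L := q.+1%:R * r0 - 1 in L0 *.
have n0 : 0 < n%:R :> R by rewrite ltr0n (leq_ltn_trans _ an).
have an1 : a.+1%:R <= n%:R :> R by rewrite ler_nat.
have scale (b : R) : (b * (L / n%:R)) = b * L / n%:R by rewrite mulrA.
apply/seteqP; split => x; rewrite /cell /= in_itv /=.
  case=> /asboolP; rewrite lensE ?(leqW jq)// -/L => /andP[x0 xL].
  rewrite /cell_index -/L; set t := offset r0 j x / L * n%:R => ta.
  have t0 : 0 <= t by rewrite mulr_ge0 ?divr_ge0// ltW.
  have /andP[] := truncn_itv t0; rewrite ta.
  rewrite /t mulrAC ler_pdivlMr// ltr_pdivrMr// => h1 h2.
  have h1' : a%:R * (L / n%:R) <= offset r0 j x by rewrite scale ler_pdivrMr.
  have h2' : offset r0 j x < a.+1%:R * (L / n%:R) by rewrite scale ltr_pdivlMr.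
  move: x0 xL h1' h2'; rewrite /offset => x0 xL h1' h2'.
  apply/andP; split; first lra.
  by case: eqP h1' => [->|_]; rewrite /Order.lteif /= => h1'; lra.
move=> /andP[h1 h2].
have h2' : a%:R * (L / n%:R) <= offset r0 j x.
  by move: h2; rewrite /offset; case: eqP; rewrite /Order.lteif /= => _ h2; lra.
have h1' : offset r0 j x < a.+1%:R * (L / n%:R) by rewrite /offset; lra.
have st0 : 0 < L / n%:R by rewrite divr_gt0.
have x0 : 0 < offset r0 j x.
  have [a0|a0] := posnP a; last by apply: lt_le_trans h2'; rewrite mulr_gt0// ltr0n.
  by move: h2; rewrite a0 /Order.lteif /= mul0r subr0 /offset subr_gt0.
have xL : offset r0 j x < L.
  apply: (lt_le_trans h1'); rewrite scale ler_pdivrMr// mulrC ler_wpM2l// ltW//.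
split; first by apply/asboolP; rewrite lensE ?(leqW jq)// x0.
rewrite /cell_index -/L; apply/eqP; rewrite truncn_eq; last first.
  by rewrite mulr_ge0 ?divr_ge0// ltW.
rewrite mulrAC ler_pdivlMr// ltr_pdivrMr//.
by move: h1' h2'; rewrite !scale ltr_pdivlMr// ler_pdivrMr// => -> ->.
Qed.

Lemma measurable_cell (R : realType) (q : nat) (r0 : R) n j a :
  1 < q.+1%:R * r0 -> (j <= q)%N -> (a < n)%N -> measurable (cell q r0 n j a).
Proof. by move=> qr jq an; rewrite cell_itv//; exact: measurable_itv. Qed.

Lemma lebesgue_measure_cell (R : realType) (q : nat) (r0 : R) n j a :
  1 < q.+1%:R * r0 -> (j <= q)%N -> (a < n)%N ->
  fine (lebesgue_measure (cell q r0 n j a)) = (q.+1%:R * r0 - 1) / n%:R.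
Proof.
move=> qr jq an; rewrite cell_itv// lebesgue_measure_itv /=.
have n0 : 0 < n%:R :> R by rewrite ltr0n (leq_ltn_trans _ an).
have st0 : 0 < (q.+1%:R * r0 - 1) / n%:R by rewrite divr_gt0// subr_gt0.
set st := (q.+1%:R * r0 - 1) / n%:R in st0 *.
rewrite lte_fin -[a.+1]addn1 natrD ifT /=; lra.
Qed.

Lemma lebesgue_measure_lens (R : realType) (q : nat) (r0 : R) j :
  1 < q.+1%:R * r0 -> (j <= q.+1)%N ->
  fine (lebesgue_measure (lens q.+1 j r0)) = q.+1%:R * r0 - 1.
Proof.
move=> qr jq; rewrite /lens lebesgue_measure_itv /= lte_fin natrB// ifT /=; lra.
Qed.

Lemma lens_sub01 (R : realType) (q : nat) (r0 : R) j :
  q%:R * r0 < 1 -> 1 < q.+1%:R * r0 -> (0 < j <= q)%N -> lens q.+1 j r0 `<=` `[0, 1].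
Proof.
move=> qr1 qr /andP[j0 jq] x /asboolP; rewrite lensE ?(leqW jq)// /offset => /andP[h1 h2].
have r00 : 0 < r0 by have := ltr0Sn R q; nra.
have j1 : 1 <= j%:R :> R by rewrite ler1n.
have jqR : j%:R <= q%:R :> R by rewrite ler_nat.
move: h2; rewrite /= in_itv /= -[q.+1]addn1 natrD => h2.
apply/andP; split; nra.
Qed.

Lemma lens_disjoint (R : realType) (q : nat) (r0 : R) i j x :
  q%:R * r0 < 1 -> 1 < q.+1%:R * r0 -> (0 < i <= q)%N -> (0 < j <= q)%N ->
  lens q.+1 i r0 x -> lens q.+1 j r0 x -> i = j.
Proof.
move=> qr1 qr.
have r00 : 0 < r0 by have := ltr0Sn R q; nra.
wlog ij : i j / (i <= j)%N.
  move=> H iq jq xi xj; have [|/ltnW] := leqP i j => ij; first exact: H.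
  by apply/esym/H.
move=> /andP[i0 iq] /andP[j0 jq] /asboolP + /asboolP.
rewrite !lensE ?(leqW iq) ?(leqW jq)// /offset => /andP[h1 h2] /andP[h3 h4].
apply/eqP; rewrite eqn_leq ij /= leqNgt; apply/negP => ij1.
have : i%:R + 1 <= j%:R :> R by rewrite natr1 ler_nat.
by move: h2 h4; rewrite -[q.+1]addn1 natrD => *; nra.
Qed.

(** Enumeration transfers independence from families over ['I_p] to finite types such as pairs of a
    cell and a lens. *)
Lemma poisson_fin_family (R : realType) (d : measure_display)
    (T : measurableType d) (P : probability T R) (lam : R) (X : T -> seq R)
    (J : finType) (A : J -> set R) (c : J -> nat) :
  is_poisson_pp P lam X ->
  (forall j, measurable (A j)) -> (forall j, A j `<=` `[0, 1]) ->
  (forall i j x, A i x -> A j x -> i = j) ->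
  P [set t | forall j, npts (A j) (X t) = c j] =
  (\prod_j pois_pmf (lam * fine (lebesgue_measure (A j))) (c j))%:E.
Proof.
move=> [_ _ PX] mA A01 Adisj.
have := PX #|J| (A \o enum_val) (c \o enum_val).
rewrite (_ : \bigcap_(_ in _) _ = [set t | forall j, npts (A j) (X t) = c j]).
  move=> ->.
  - by congr (_%:E); rewrite [RHS](reindex_onto enum_val enum_rank) //= => [|j _];
      [apply: eq_bigl => i; rewrite enum_valK eqxx|exact: enum_rankK].
  - by move=> i; split; [exact: mA|exact: A01].
  - move=> i j ij; apply/seteqP; split => // x [xi xj]; move/eqP: ij; apply.
    exact/enum_val_inj/(Adisj _ _ x).
apply/seteqP; split => t /= h => [j|i _]; last exact: h.
by have := h (enum_rank j) I; rewrite /= enum_rankK.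
Qed.

(** * Measurability of the number of paths *)

Definition level_measurable {d : measure_display} {T : measurableType d} (f : T -> nat) : Prop :=
  forall n, measurable [set t | f t = n].

Lemma level_measurable_cst (d : measure_display) (T : measurableType d)
    (k : nat) : @level_measurable d T (fun=> k).
Proof.
move=> n; have [->|kn] := eqVneq k n.
  by rewrite (_ : [set _ | _] = setT)//; apply/seteqP; split.
by rewrite (_ : [set _ | _] = set0)//; apply/seteqP; split => // t /= /eqP; rewrite (negPf kn).
Qed.

Lemma level_measurable_op (d : measure_display) (T : measurableType d) (h : nat -> nat -> nat)
    (f g : T -> nat) :
  level_measurable f -> level_measurable g -> level_measurable (fun t => h (f t) (g t)).
Proof.
move=> mf mg n.
rewrite (_ : [set _ | _] = \bigcup_a \bigcup_b
   if h a b == n then [set t | f t = a] `&` [set t | g t = b] else set0).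
  apply: bigcupT_measurable => a; apply: bigcupT_measurable => b.
  by case: ifP => _; [exact: measurableI|exact: measurable0].
apply/seteqP; split => t /=.
  by move=> <-; exists (f t) => //; exists (g t) => //; rewrite eqxx.
by case=> a _ [b _]; case: eqP => // <- [/= -> ->].
Qed.

Lemma level_measurable_sum (d : measure_display) (T : measurableType d) n (F : 'I_n -> T -> nat) :
  (forall i, level_measurable (F i)) -> level_measurable (fun t => \sum_i F i t)%N.
Proof.
elim: n F => [|n IH] F mF.
  rewrite (_ : (fun t => _) = fun=> 0%N); first exact: level_measurable_cst.
  by apply/funext => t; rewrite big_ord0.
rewrite (_ : (fun t => _) = fun t => (\sum_(i < n) F (widen_ord (leqnSn n) i) t
    + F ord_max t)%N); last by apply/funext => t; rewrite big_ord_recr.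
apply: (level_measurable_op _ _ addn) => //.
by apply: IH => i; exact: mF.
Qed.

Lemma level_measurable_nchain (R : realType) (d : measure_display) (T : measurableType d)
    (P : probability T R) (lam : R) (X : T -> seq R) (q : nat) (r0 : R) n i a :
  is_poisson_pp P lam X -> 1 < q.+1%:R * r0 -> (i <= q)%N -> (a <= n)%N ->
  level_measurable (fun t => nchain (occupied q r0 n (X t)) i a).
Proof.
move=> [_ mX _] qr; elim: i a => [|i IH] a iq an; first exact: level_measurable_cst.
apply: level_measurable_sum => b; have bn : (b < n)%N := leq_trans (ltn_ord b) an.
apply: (level_measurable_op _ _ muln); last by apply: IH; exact: ltnW.
(* Occupancy is a function of one count; the second argument is a dummy constant. *)
apply: (level_measurable_op _ _ (fun m _ => (0 < m)%N : nat)
  (fun t => npts (cell q r0 n i.+1 b) (X t)) (fun=> 0%N)).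
  by move=> m; apply: mX; exact: measurable_cell.
exact: level_measurable_cst.
Qed.

(* [P] need not be complete, so the event must be measurable also on configurations
   with coinciding points: for every configuration, all fine enough partitions
   separate the distinct offsets and then compute [sigma_k]. *)
Lemma measurable_sigma_k (R : realType) (d : measure_display) (T : measurableType d)
    (P : probability T R) (lam : R) (X : T -> seq R) (q : nat) (r0 : R) n :
  is_poisson_pp P lam X -> (0 < q)%N -> q%:R * r0 < 1 -> 1 < q.+1%:R * r0 ->
  measurable [set t | sigma_k q.+1 r0 (X t) = n].
Proof.
move=> PX q0 qr1 qr; rewrite (_ : [set _ | _] = \bigcup_N \bigcap_(N' in [set N' | (N <= N')%N])
   [set t | nchain (occupied q r0 N'.+1 (X t)) q N'.+1 = n]).
  apply: bigcupT_measurable => N; apply: bigcap_measurable => [|N' _].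
    by exists N => /=.
  exact: (level_measurable_nchain _ _ _ P lam).
apply/seteqP; split => t /=.
  have [n0 sep] := eventually_separated R q r0 (X t) qr.
  move=> <-; exists n0 => // N' /= N0N'; rewrite -sigma_k_nchain//.
  by apply: sep; exact: leqW.
case=> N _ h; have [n0 sep] := eventually_separated R q r0 (X t) qr.
rewrite (sigma_k_nchain _ _ _ (maxn N n0).+1)//.
  by apply: h => /=; exact: leq_maxl.
by apply: sep; apply: leqW; exact: leq_maxr.
Qed.

(** * Probabilities of words and lower bounds *)

Lemma sum_measure_disjoint_le (R : realType) (d : measure_display)
    (T : measurableType d) (P : {measure set T -> \bar R}) (I : eqType) (s : seq I)
    (Q : pred I) (F : I -> set T) (A : set T) :
  uniq s -> measurable A -> (forall i, Q i -> measurable (F i)) ->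
  (forall i, i \in s -> Q i -> F i `<=` A) ->
  (forall i j t, Q i -> Q j -> F i t -> F j t -> i = j) ->
  (\sum_(i <- s | Q i) P (F i) <= P A)%E.
Proof.
move=> + + mF + Fdisj; elim: s A => [|i s IH] A; first by rewrite big_nil.
move=> /= /andP[nis us] mA FA; rewrite big_cons.
have FAs j : j \in s -> Q j -> F j `<=` A.
  by move=> js; apply: FA; rewrite in_cons js orbT.
have [Qi|nQi] := boolP (Q i); last exact: IH.
have FiA : F i `<=` A by apply: FA; rewrite ?mem_head.
rewrite -[X in (_ <= P X)%E](setDUK FiA) measureU//; first last.
- by rewrite setDIK.
- exact/measurableD/mF.
- exact: mF.
apply: leeD2l; apply: IH => //; first exact/measurableD/mF.
move=> j js Qj t Fjt; split; first exact: FAs Fjt.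
by move=> Fit; move: nis; rewrite (Fdisj _ _ _ Qi Qj Fit Fjt) js.
Qed.

(** The proportion of injective choices is at least [1 - m^2 / n], here multiplied out. The
    inductive step rests on [n (n - (m+1)^2) <= (n - m^2) (n - m)]. *)
Lemma ffact_lower_bound (R : realType) (n m : nat) :
  n%:R ^+ m * (n%:R - m%:R ^+ 2) <= (n ^_ m)%:R * n%:R :> R.
Proof.
elim: m => [|m IH]; first by rewrite ffactn0 !expr0 expr0n subr0.
have n0 : 0 <= n%:R :> R by [].
have m0 : 0 <= m%:R :> R by [].
have [mn|nm] := leqP m n; last first.
  rewrite ffact_small ?ltnS 1?ltnW// mul0r mulr_ge0_le0 ?exprn_ge0//.
  have : n%:R <= m%:R :> R by rewrite ler_nat ltnW.
  by rewrite -natr1; nra.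
have mnR : m%:R <= n%:R :> R by rewrite ler_nat.
rewrite ffactnSr natrM natrB// exprSr.
have := ler_wpM2r (_ : 0 <= n%:R - m%:R) IH; rewrite subr_ge0 => /(_ mnR).
set a := n%:R ^+ m; have a0 : 0 <= a by rewrite exprn_ge0.
move=> h; have -> : (n ^_ m)%:R * (n%:R - m%:R) * n%:R = (n ^_ m)%:R * n%:R * (n%:R - m%:R) :> R.
  by rewrite mulrAC.
apply: le_trans h; rewrite -natr1 -!mulrA ler_wpM2l//; nra.
Qed.

(** The lower half of the Poisson limit of [C(n, m) (x / n)^m], with relative error [m^2 / n]. *)
Lemma binomial_lower_bound (R : realType) (n m : nat) (x : R) : 0 <= x -> (0 < n)%N ->
  x ^+ m / m`!%:R * (1 - m%:R ^+ 2 / n%:R) <= 'C(n, m)%:R * (x / n%:R) ^+ m.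
Proof.
move=> x0 n0; have n0R : 0 < n%:R :> R by rewrite ltr0n.
have f0 : 0 < m`!%:R :> R by rewrite ltr0n fact_gt0.
have nm0 : 0 < n%:R ^+ m :> R by rewrite exprn_gt0.
have -> : 'C(n, m)%:R = (n ^_ m)%:R / m`!%:R :> R.
  by rewrite -bin_ffact natrM mulfK// gt_eqF.
rewrite expr_div_n [leRHS](_ : _ = x ^+ m / m`!%:R * ((n ^_ m)%:R / n%:R ^+ m)); last first.
  by rewrite mulrACA [RHS]mulrACA [(n ^_ m)%:R * _]mulrC.
rewrite ler_wpM2l ?divr_ge0 ?exprn_ge0// ler_pdivlMr//.
rewrite -(ler_pM2r n0R); apply: le_trans (ffact_lower_bound R n m).
rewrite (_ : _ * n%:R = n%:R ^+ m * (n%:R - m%:R ^+ 2))//.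
by field; rewrite gt_eqF.
Qed.

Lemma cells_spellE (R : realType) (q : nat) (r0 : R) (w : seq nat) (s : seq R) :
  cells_spell q r0 w s <-> forall p : 'I_(size w) * 'I_q,
    npts (cell q r0 (size w) p.2.+1 p.1) s = (nth 0%N w p.1 == p.2.+1).
Proof.
split=> [h [a j]|h j a /andP[j0 jq] aw]; first by rewrite h//= ltn_ord.
have jq' : (j.-1 < q)%N by rewrite prednK.
by have := h (Ordinal aw, Ordinal jq'); rewrite /= prednK.
Qed.

Lemma measurable_cells_spell (R : realType) (d : measure_display)
    (T : measurableType d) (P : probability T R) (lam : R) (X : T -> seq R)
    (q : nat) (r0 : R) (w : seq nat) :
  is_poisson_pp P lam X -> 1 < q.+1%:R * r0 ->
  measurable [set t | cells_spell q r0 w (X t)].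
Proof.
move=> [_ mX _] qr.
rewrite (_ : [set t | _] = \bigcap_(p in [set: 'I_(size w) * 'I_q])
   [set t | npts (cell q r0 (size w) p.2.+1 p.1) (X t) = (nth 0%N w p.1 == p.2.+1)]).
  apply: fin_bigcap_measurable => [|[a j] _]; first exact: finite_finset.
  by apply: mX; exact: measurable_cell.
apply/seteqP; split => t /=.
  by move=> /cells_spellE h p _; exact: h.
by move=> h; apply/cells_spellE => p; exact: h.
Qed.

(** Every cell has Poisson mean [mu / size w]. The occupied cells contribute this mean once each,
    and the exponentials of all cells multiply to that of the [q] lenses. The result depends only on
    the numbers of cells and of letters, whence the conditional uniformity. *)
Lemma prob_cells_spell (R : realType) (d : measure_display) (T : measurableType d)
    (P : probability T R) (lam : R) (X : T -> seq R) (q : nat) (r0 : R)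
    (m : nat -> nat) (w : seq nat) :
  is_poisson_pp P lam X -> q%:R * r0 < 1 -> 1 < q.+1%:R * r0 -> (0 < size w)%N ->
  profile q m w ->
  let mu := lam * (q.+1%:R * r0 - 1) in
  P [set t | cells_spell q r0 w (X t)] =
  ((mu / (size w)%:R) ^+ (\sum_(1 <= i < q.+1) m i) * expR (- (q%:R * mu)))%:E.
Proof.
move=> PX qr1 qr w0 wm mu.
rewrite (_ : [set t | _] = [set t | forall p : 'I_(size w) * 'I_q,
   npts (cell q r0 (size w) p.2.+1 p.1) (X t) = (nth 0%N w p.1 == p.2.+1)]); last first.
  by apply/seteqP; split => t /cells_spellE.
rewrite (poisson_fin_family _ _ _ P lam)//; first last.
- move=> [a i] [b j] x /= [xi xa] [xj xb].
  have ij : i.+1 = j.+1 by apply: (lens_disjoint R q r0 _ _ x); rewrite /= ?ltn_ord.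
  congr pair; apply: val_inj; last by case: ij.
  by rewrite /= -xa -xb ij.
- by move=> [a j] /= x [xl _]; apply: (lens_sub01 R q r0 j.+1); rewrite /= ?ltn_ord.
- by move=> [a j] /=; exact: measurable_cell.
congr (_%:E).
transitivity (\prod_(p : 'I_(size w) * 'I_q)
   ((mu / (size w)%:R) ^+ (nth 0%N w p.1 == p.2.+1) * expR (- (mu / (size w)%:R)))).
  apply: eq_bigr => -[a j] _ /=; rewrite lebesgue_measure_cell// /pois_pmf mulrA.
  by case: eqP => _; rewrite divr1.
rewrite big_split /= prodr_const card_prod !card_ord prodrXr; congr (_ ^+ _ * _).
  rewrite -(pair_bigA _ (fun (a : 'I_(size w)) (j : 'I_q) => nat_of_bool (nth 0%N w a == j.+1))) /=.
  rewrite exchange_big /= big_add1 /= big_mkord; apply: eq_bigr => j _.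
  move/forallP/(_ j)/eqP: wm => <-.
  by rewrite -sum1_count [RHS](big_nth 0%N) [RHS]big_mkcond [RHS]big_mkord;
    apply: eq_bigr => a _ /=; case: eqP.
rewrite -expRM_natl mulrN; congr (expR (- _)).
have n0R : (size w)%:R != 0 :> R by rewrite pnatr_eq0 -lt0n.
by rewrite natrM; field.
Qed.

(** The product of Poisson weights takes the form of the number of words times the limiting weight
    of a single word. *)
Lemma prob_lens_counts (R : realType) (d : measure_display) (T : measurableType d)
    (P : probability T R) (lam : R) (X : T -> seq R) (q : nat) (r0 : R)
    (m : nat -> nat) :
  is_poisson_pp P lam X -> q%:R * r0 < 1 -> 1 < q.+1%:R * r0 ->
  let mu := lam * (q.+1%:R * r0 - 1) in
  let M := (\sum_(1 <= i < q.+1) m i)%N in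
  P [set t | forall i : 'I_q, npts (lens q.+1 i.+1 r0) (X t) = m i.+1] =
  ((multinom q m)%:R * (mu ^+ M / M`!%:R * expR (- (q%:R * mu))))%:E.
Proof.
move=> PX qr1 qr mu M.
rewrite (poisson_fin_family _ _ _ P lam)//; first last.
- move=> i j x xi xj; apply: val_inj; apply/succn_inj.
  by apply: (lens_disjoint R q r0 _ _ x); rewrite /= ?ltn_ord.
- by move=> j; apply: lens_sub01; rewrite /= ?ltn_ord.
- by move=> j; exact: measurable_itv.
congr (_%:E).
rewrite (eq_bigr (fun j : 'I_q => mu ^+ m j.+1 * (m j.+1)`!%:R^-1 * expR (- mu))); last first.
  by move=> j _; rewrite /pois_pmf lebesgue_measure_lens// ltnW// ltnS.
rewrite !big_split /= prodr_const card_ord -expRM_natl mulrN mulrA; congr (_ * _).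
rewrite prodrXr (_ : \sum_(i < q) _ = M)%N; last by rewrite /M big_add1 /= big_mkord.
rewrite mulrCA; congr (_ * _); rewrite prodfV -natr_prod.
have F0 : (0 < \prod_(i < q) (m i.+1)`!)%N by apply/prodn_gt0 => i; exact: fact_gt0.
have multF : (multinom q m * \prod_(i < q) (m i.+1)`!)%N = M`!.
  rewrite -multinomE -[RHS](count_words q M (fun i : 'I_q => m i.+1)).
    by rewrite big_mkcond.
  by rewrite /M big_add1 /= big_mkord.
have FR : (\prod_(i < q) (m i.+1)`!)%:R != 0 :> R by rewrite pnatr_eq0 -lt0n.
have MR : M`!%:R != 0 :> R by rewrite pnatr_eq0 -lt0n fact_gt0.
by apply: (mulIf FR); rewrite mulVf// mulrAC -natrM multF divff.
Qed.

(** For [n] cells, the events spelling favourable words with blanks are disjoint and lie in [A], and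
    each word has [C(n, M)] fillings; then [n] grows. *)
Lemma prob_sigma_k_ge (R : realType) (d : measure_display) (T : measurableType d)
    (P : probability T R) (lam : R) (X : T -> seq R) (q : nat) (r0 : R)
    (m : nat -> nat) (F : pred nat) (A : set T)
    (mu := lam * (q.+1%:R * r0 - 1)) (M := (\sum_(1 <= i < q.+1) m i)%N) :
  0 < lam -> is_poisson_pp P lam X -> (0 < q)%N -> q%:R * r0 < 1 -> 1 < q.+1%:R * r0 ->
  measurable A ->
  (forall t, F (sigma_k q.+1 r0 (X t)) ->
     (forall i : 'I_q, npts (lens q.+1 i.+1 r0) (X t) = m i.+1) -> A t) ->
  (\sum_(w : M.-tuple 'I_q | wordsP w) F (nsub q (letters w)))%:R *
    (mu ^+ M / M`!%:R * expR (- (q%:R * mu))) <= fine (P A).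
Proof.
move=> lam0 PX q0 qr1 qr mA FA.
have mu0 : 0 <= mu by rewrite mulr_ge0 ?subr_ge0// ltW.
set W := (\sum_(w | _) _)%N; set E := expR _.
have E0 : 0 < E by exact: expR_gt0.
have Pfin : P A \is a fin_num by exact: fin_num_measure.
have bound n : (0 < n)%N ->
    W%:R * ('C(n, M)%:R * (mu / n%:R) ^+ M * E) <= fine (P A).
  move=> n0; rewrite -lee_fin fineK//.
  pose spell (t : n.-tuple 'I_q.+1) := [set u | cells_spell q r0 (vals t) (X u)].
  have sz (t : n.-tuple 'I_q.+1) : size (vals t) = n by rewrite size_map size_tuple.
  have Pspell (t : n.-tuple 'I_q.+1) : profile q m (vals t) ->
      P (spell t) = ((mu / n%:R) ^+ M * E)%:E.
    by move=> tm; rewrite /spell (prob_cells_spell _ _ _ _ lam _ _ _ m)// sz.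
  have mspell (t : n.-tuple 'I_q.+1) : measurable (spell t).
    exact: (measurable_cells_spell _ _ _ P lam).
  apply: le_trans (sum_measure_disjoint_le _ _ _ P _ (index_enum (n.-tuple 'I_q.+1 : finType))
    [pred t : n.-tuple 'I_q.+1 | profile q m (vals t) && F (nsub q (vals t))] spell A
    (index_enum_uniq _) mA _ _ _).
  - rewrite (eq_bigr (fun=> ((mu / n%:R) ^+ M * E)%:E)); last first.
      by move=> t /andP[tm _]; exact: Pspell.
    rewrite sumEFin lee_fin big_const_seq iter_addr_0 -mulrA mulrA -natrM -[leRHS]mulr_natl.
    have v0 : 0 <= (mu / n%:R) ^+ M * E.
      by rewrite mulr_ge0 ?exprn_ge0 ?divr_ge0 ?expR_ge0.
    rewrite ler_wpM2r// ler_nat.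
    rewrite mulnC -(sum_blank_words _ _ _ (fun k => F k : nat)) -sum1_count.
    rewrite big_mkcondr /= leq_eqVlt; apply/orP; left; apply/eqP.
    by apply: eq_bigr => t _; case: (F _).
  - by [].
  - move=> t _ /andP[/forallP tm Ft] u ut; apply: FA.
      by rewrite (sigma_k_spell _ _ _ (vals t))// sz.
    move=> i; rewrite (npts_lens_spell _ q _ (vals t))// ?sz//=; exact/eqP.
  (* A configuration spells only one word: the lens with a point in cell [a] determines the letter,
     and the absence of such a lens means a blank. *)
  - move=> t1 t2 u _ _ u1 u2; apply/val_inj/(inj_map val_inj).
    rewrite -!/(vals _); apply: (eq_from_nth (x0 := 0%N)); rewrite !sz// => a an.
    have lq (t : n.-tuple 'I_q.+1) : (nth 0%N (vals t) a <= q)%N.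
      rewrite -ltnS; have : nth 0%N (vals t) a \in vals t by rewrite mem_nth ?sz.
      by case/mapP => x _ ->; exact: ltn_ord.
    have agree j : (0 < j <= q)%N -> (nth 0%N (vals t1) a == j) = (nth 0%N (vals t2) a == j).
      move=> jq; have e1 := u1 j a jq; have e2 := u2 j a jq; rewrite !sz in e1 e2.
      by have := e1 an; rewrite (e2 an); do 2 case: (_ == j).
    have [z1|p1] := posnP (nth 0%N (vals t1) a); last first.
      by apply/esym/eqP; rewrite -agree ?eqxx// p1 lq.
    have [z2|p2] := posnP (nth 0%N (vals t2) a); first by rewrite z1 z2.
    by apply/eqP; rewrite agree ?eqxx// p2 lq.
rewrite leNgt; apply/negP; set c := W%:R * _ => cA.
have c0 : 0 <= c by rewrite !mulr_ge0 ?invr_ge0 ?exprn_ge0 ?expR_ge0.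
have lower n : (0 < n)%N -> c * (1 - M%:R ^+ 2 / n%:R) <= fine (P A).
  move=> n0; apply: le_trans (bound n n0).
  rewrite /c -mulrA ler_wpM2l// mulrAC ler_wpM2r ?expR_ge0//.
  exact: binomial_lower_bound.
pose e := c - fine (P A); have e0 : 0 < e by rewrite subr_gt0.
(* With this many cells the error [c M^2 / n] is below the supposed excess [e] of [c] over the
   probability of [A]. *)
pose n := (Num.truncn (c * M%:R ^+ 2 / e)).+1.
have n0 : 0 < n%:R :> R by rewrite ltr0n.
have small : c * M%:R ^+ 2 / n%:R < e.
  by rewrite ltr_pdivrMr// [e * _]mulrC -ltr_pdivrMr//; exact: truncnS_gt.
have := lower n isT; rewrite mulrBr mulr1 mulrA leNgt => /negP[].
by move: small; rewrite /e; lra.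
Qed.

(** For [k = e.+3] the words [w] use [e.+1] letters, and their shuffles with [Pi] use [e.+2], one
    per lens. *)
Lemma rhs21E (R : realType) (e : nat) (m : nat -> nat) (n : nat) :
  rhs21 e.+3 m n = (multinom e.+2 m)%:R^-1 * (good_words e.+2 m n)%:R :> R.
Proof.
rewrite -sum_words_shuffles// /rhs21; congr (_ * _).
rewrite natr_sum; apply: eq_bigr => w _.
by rewrite natr_sum.
Qed.

(** * The conditional distribution of the number of paths *)

Theorem theorem2p1 (R : realType) (d : measure_display) (T : measurableType d)
    (P : probability T R) (lam : R) (X : T -> seq R) (k : nat) (r0 : R)
    (m : nat -> nat) (n : nat) :
  0 < lam -> is_poisson_pp P lam X ->
  (3 <= k)%N -> k%:R^-1 < r0 -> r0 < (k - 1)%:R^-1 ->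
  cond_prob P [set t | sigma_k k r0 (X t) = n]
              [set t | forall j : nat, (1 <= j <= k - 1)%N ->
                         npts (lens k j r0) (X t) = m j]
  = rhs21 k m n.
Proof.
case: k => [|[|[|e]]]// lam0 PX _; rewrite subn1 /= => kr rk.
pose q := e.+2.
have qr1 : q%:R * r0 < 1 by move: rk; rewrite -[_^-1]mul1r ltr_pdivlMr// mulrC.
have qr : 1 < q.+1%:R * r0 by move: kr; rewrite -[_^-1]mul1r ltr_pdivrMr// mulrC.
rewrite rhs21E -/q /cond_prob.
pose B := [set t | forall i : 'I_q, npts (lens q.+1 i.+1 r0) (X t) = m i.+1].
rewrite (_ : [set t | forall j, _] = B); last first.
  apply/seteqP; split => t /= h => [i|j /andP[j0 jq]].
    by apply: h; rewrite /= ltn_ord.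
  have jq' : (j.-1 < q)%N by rewrite prednK.
  by have := h (Ordinal jq'); rewrite /= prednK.
set S := [set t | _].
have mS : measurable S by exact: (measurable_sigma_k _ _ _ P lam).
have mB : measurable B.
  have [_ mX _] := PX.
  rewrite (_ : B = \bigcap_(i in [set: 'I_q])
      [set t | npts (lens q.+1 i.+1 r0) (X t) = m i.+1]); last first.
    by apply/seteqP; split => t /= h => [i _|i]; exact: h.
  apply: fin_bigcap_measurable => [|i _]; first exact: finite_finset.
  by apply: mX; exact: measurable_itv.
have PB := prob_lens_counts _ _ _ P lam X q r0 m PX qr1 qr.
rewrite /= -/B in PB.
(* The lower bound is applied to the event and to its complement within [B]. *)
have S_ge := prob_sigma_k_ge _ _ _ P lam X q r0 m (pred1 n) (S `&` B) lam0 PX isT qr1 qr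
  (measurableI _ _ mS mB).
have SC_ge := prob_sigma_k_ge _ _ _ P lam X q r0 m (predC (pred1 n)) (B `\` S) lam0 PX isT qr1 qr
  (measurableD mB mS).
have {}S_ge := S_ge (fun t (st : sigma_k q.+1 r0 (X t) == n) bt => conj (eqP st) bt).
have {}SC_ge := SC_ge (fun t (st : sigma_k q.+1 r0 (X t) != n) bt =>
  conj bt (fun h : S t => elimN eqP st h)).
have PBsplit : fine (P B) = fine (P (S `&` B)) + fine (P (B `\` S)).
  rewrite -fineD ?fin_num_measure//; [|exact: measurableI|exact: measurableD].
  congr fine; rewrite setIC -[X in P X = _](setUIDK B S) measureU//.
  - exact: measurableI.
  - exact: measurableD.
  - by apply/seteqP; split => // t [[_ St] [_ nSt]]; exact: nSt.
(* The common weight [c] of a single word is positive and cancels in the quotient. *)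
set c := _ * expR _ in PB S_ge SC_ge.
have c0 : 0 < c.
  by rewrite mulr_gt0 ?expR_gt0// divr_gt0// exprn_gt0// mulr_gt0// subr_gt0.
have Wsplit : (\sum_(w : (\sum_(1 <= i < q.+1) m i)%N.-tuple 'I_q | wordsP w)
     pred1 n (nsub q (letters w)) +
   \sum_(w : (\sum_(1 <= i < q.+1) m i)%N.-tuple 'I_q | wordsP w)
     predC (pred1 n) (nsub q (letters w)))%N = multinom q m.
  by rewrite -multinomE -big_split; apply: eq_bigr => w _ /=; case: (_ == n).
have fPB : fine (P B) = (multinom q m)%:R * c by rewrite PB.
(* The two lower bounds add up to the probability of [B], so neither is strict. *)
have PSB : fine (P (S `&` B)) = (good_words q m n)%:R * c.
  apply/eqP; rewrite eq_le S_ge andbT.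
  rewrite PBsplit -Wsplit natrD mulrDl in fPB.
  by rewrite -(lerD2r (fine (P (B `\` S)))) fPB lerD2l.
by rewrite PSB fPB -mulf_div divff ?gt_eqF// mulr1 mulrC.
Qed.
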